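(* Let $p\ge2$. An upper bound on the total number of segments of a lasso solution with normalized data in dimension $p$ is $$\bar N(p)=\binom p0h_{p,2}+\binom p1h_{p-1,2}+\dots+\binom p{p-2}h_{2,2}+2 .$$ Moreover, for every integer $\ell\ge1$, $$\bar N(2\ell)=\frac{3^{2\ell}+4-{}_2F_1\left(-\ell,\frac12-\ell;1;4\right)}{2}-2\ell\binom{2\ell-2}{\ell-1}\,{}_3F_2\left(1-\ell,\,1-\ell,\,\tfrac12-\ell;\ \tfrac32,\,\tfrac32-\ell;\ \tfrac14\right)$$ and $$\bar N(2\ell+1)=\frac{3^{2\ell+1}+4-{}_2F_1\left(-\ell,-\ell-\frac12;1;4\right)}{2}-(2\ell+1)\,{}_3F_2\left(-\ell,\,\tfrac12-\ell,\,\tfrac12;\ 1,\,\tfrac32;\ 4\right).$$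
   Context: A data set consists of $N$ points $(x_1^{(i)},\dots,x_p^{(i)},y^{(i)})\in\mathbb R^{p+1}$ with centroid at the origin and not contained in any proper affine subspace (full rank assumption). Put $K=\frac1N\sum_i x^{(i)}(x^{(i)})^T$ (the $p\times p$ covariance matrix of the predictors, which is positive definite), $b=\frac1N\sum_i y^{(i)}x^{(i)}\in\mathbb R^p$, $\hat\beta=K^{-1}b$, $\hat t=\sum_j|\hat\beta_j|$. The data are normalized if $K_{jj}=1$ for all $j$. For $t\ge0$ the lasso estimate $\beta(t)$ is the unique minimizer of $f(\beta)=\frac12\sum_i\big(y^{(i)}-\sum_j\beta_jx_j^{(i)}\big)^2$ over $\beta\in\mathbb R^p$ with $\sum_j|\beta_j|\le t$. The lasso solution (path) is the curve $t\mapsto\beta(t)$, $0\le t\le\hat t$, a polygonal chain from $\hat\beta$ to the origin. Its segments (of positive length) are the maximal portions along which the sign vector $(\operatorname{sgn}\beta_1,\dots,\operatorname{sgn}\beta_p)\in\{-1,0,1\}^p$ is constant; in the total number of segments the origin is counted as one additional, degenerate, final segment. For $1\le r\le k$, $h_{k,r}$ is the maximal number of binary words of length $k$ such that every two of them match in at least $r$ spots; $h_{2m,2}=2^{2m-1}-\frac12\binom{2m}{m}$ and $h_{2m+1,2}=2^{2m}-\binom{2m}{m}$ for $m\ge1$. Hypergeometric series: ${}_mF_n(a_1,\dots,a_m;b_1,\dots,b_n;z)=\sum_{j\ge0}\frac{(a_1)_j\cdots(a_m)_j}{(b_1)_j\cdots(b_n)_j}\frac{z^j}{j!}$ with $(a)_j=a(a+1)\cdots(a+j-1)$,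 $(a)_0=1$; all series above terminate. *)

(* Defs.v *)
From HB Require Import structures.
From mathcomp Require Import all_boot all_order all_algebra.
From mathcomp Require Import all_classical all_reals all_analysis.

Set Implicit Arguments.
Unset Strict Implicit.
Unset Printing Implicit Defensive.
Import Order.TTheory GRing.Theory Num.Theory.
Import numFieldNormedType.Exports.
Local Open Scope classical_set_scope.
Local Open Scope ring_scope.

(** * Data sets *)

(* A data set of N points in R^(p+1): row i of X holds the predictors of the
   i-th point and y i 0 holds its response. *)
Section Data.
Variables (R : realType) (p N : nat) (X : 'M[R]_(N, p)) (y : 'cV[R]_N).

Definition data_point (i : 'I_N) : 'rV[R]_(p + 1) := row i (row_mx X y).

Definition centered : Prop := N%:R^-1 *: \sum_(i < N) data_point i = 0.

(* Every affine subspace v + V that contains all the points is the whole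
   space; in particular N > 0. *)
Definition full_rank_data : Prop :=
  forall (v : 'rV[R]_(p + 1)) (V : {vspace 'rV[R]_(p + 1)}),
    (forall i : 'I_N, data_point i - v \in V) -> V = fullv.

Definition covariance : 'M[R]_p := N%:R^-1 *: (X^T *m X).

Definition normalized : Prop := forall j : 'I_p, covariance j j = 1.

Definition xy_covariance : 'cV[R]_p := N%:R^-1 *: (X^T *m y).

Definition beta_hat : 'cV[R]_p := invmx covariance *m xy_covariance.

Definition l1norm (b : 'cV[R]_p) : R := \sum_(j < p) `|b j 0|.

Definition t_hat : R := l1norm beta_hat.

(** * The lasso path *)

Definition sq_loss (b : 'cV[R]_p) : R :=
  2^-1 * \sum_(i < N) (y i 0 - \sum_(j < p) b j 0 * X i j) ^+ 2.

(* For centered data of full rank the loss is strictly convex, so that for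
   t >= 0 exactly one b satisfies this. *)
Definition is_lasso_estimate (t : R) (b : 'cV[R]_p) : Prop :=
  l1norm b <= t /\
  forall c : 'cV[R]_p, l1norm c <= t -> sq_loss b <= sq_loss c.

Definition is_lasso_path (beta : R -> 'cV[R]_p) : Prop :=
  forall t : R, 0 <= t -> is_lasso_estimate t (beta t).

Definition sign_vector (b : 'cV[R]_p) : 'cV[R]_p := map_mx Num.sg b.

(* Portions of the path are given by their sets of parameters t. Nothing is
   lost, as l1norm (beta t) = t for 0 <= t <= t_hat. *)
Definition constant_sign_portion (beta : R -> 'cV[R]_p) (I : set R) : Prop :=
  [/\ is_interval I,
      I `<=` [set t | 0 <= t <= t_hat]
    & forall s t, I s -> I t -> sign_vector (beta s) = sign_vector (beta t)].

Definition is_segment (beta : R -> 'cV[R]_p) (I : set R) : Prop :=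
  [/\ constant_sign_portion beta I,
      forall J, constant_sign_portion beta J -> I `<=` J -> J = I
    & exists s t, [/\ I s, I t & s < t]].

(* [set 0] is the degenerate final segment formed by the origin; it has length
   zero, hence differs from all the other segments. *)
Definition lasso_segments (beta : R -> 'cV[R]_p) : set (set R) :=
  [set I | is_segment beta I] `|` [set [set 0]].

End Data.

(** * Families of binary words *)

Definition matches (k : nat) (u v : k.-tuple bool) : nat :=
  #|[set i : 'I_k | tnth u i == tnth v i]%SET|.

Definition matching_family (k r : nat) (W : {set k.-tuple bool}) : bool :=
  [forall u in W, forall v in W, (u != v) ==> (r <= matches u v)%N].

Definition max_words (k r : nat) : nat :=
  \max_(W : {set k.-tuple bool} | matching_family r W) #|W|.

Definition Nbar (p : nat) : nat :=
  (\sum_(0 <= k < p.-1) 'C(p, k) * max_words (p - k) 2 + 2)%N.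

(** * Hypergeometric series *)

Section Hypergeometric.
Variable R : realType.

Definition pochhammer (a : R) (j : nat) : R := \prod_(i < j) (a + i%:R).

Definition hypergeometric_term (a b : seq R) (z : R) (j : nat) : R :=
  (\prod_(c <- a) pochhammer c j) / (\prod_(c <- b) pochhammer c j)
  * (z ^+ j / j`!%:R).

Definition hypergeometric (a b : seq R) (z : R) : R :=
  limn (series (hypergeometric_term a b z)).

End Hypergeometric.

(* Main.v *)
(* Proof idea.  On the path the residual correlations [X^T (y - X b)] satisfy the
   KKT conditions: they are bounded by some [a >= 0] and equal [a * sgn b_j]
   where [b_j <> 0].  KKT points with a common sign vector form a convex set, so
   each sign vector contributes at most one segment.  For two KKT points with
   the same support [S] but different signs the normalization of the columns
   and Cauchy-Schwarz force the signs to match in at least two places, so at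
   most h_(|S|,2) sign vectors have support [S]; only one sign vector has a
   support of size one, as its predictor maximizes the correlation with [y].

   The numbers h_(k,2) are those of Kleitman's theorem.  Compressions turn a
   family of words into a left-shifted 2-intersecting family [F], and Katona's
   shadow inequality bounds the levels of sizes [k] and [n + 1 - k] of [F]
   together, since the complement of a set of [F] never arises by deleting one
   point of a set of [F].  Summing binomially, the powers of two give
   3^p and the central binomials the terminating hypergeometric series. *)
Require Import Defs.
From mathcomp Require Import all_boot zify.

Set Implicit Arguments.
Unset Strict Implicit.
Unset Printing Implicit Defensive.

(** * Shifted intersecting families *)

Section Compression.
Local Open Scope nat_scope.
Variables (T I : finType) (P : I -> pred T) (phi : I -> T -> T) (r : rel T) (w : T -> nat).

(** A member moves only when its image is vacant, which keeps the map injective. The move is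
    abstract because two are needed: adding a point, and replacing a point by a smaller one. *)
Definition compress (i : I) (F : {set T}) : {set T} :=
  [set (if P i A && (phi i A \notin F) then phi i A else A) | A in F].

Hypothesis phi_inj : forall i, {in P i &, injective (phi i)}.
Hypothesis w_phi : forall i A, P i A -> w (phi i A) < w A.
Hypothesis r_sym : symmetric r.
Hypothesis r_both : forall i A B, P i A -> P i B -> r A B -> r (phi i A) (phi i B).
Hypothesis r_left : forall i A B, P i A -> ~~ P i B -> r A B -> r (phi i A) B.
Hypothesis r_swap : forall i A B, P i A -> P i B -> r A (phi i B) -> r (phi i A) B.

Lemma compress_inj i (F : {set T}) :
  {in F &, injective (fun A => if P i A && (phi i A \notin F) then phi i A else A)}.
Proof.
move=> A B AF BF /=.
case: ifP => [/andP[PA nA]|_]; case: ifP => [/andP[PB nB]|_] //.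
- exact: phi_inj.
- by move=> E; rewrite E BF in nA.
- by move=> E; rewrite -E AF in nB.
Qed.

Lemma card_compress i (F : {set T}) : #|compress i F| = #|F|.
Proof. exact/card_in_imset/compress_inj. Qed.

(** If only [A] moves, then [B] is not eligible, or [phi i B] lies in [F] and is related to [A];
    [r_left] and [r_swap] settle these two cases. *)
Lemma compress_rel i (F : {set T}) :
  {in F &, forall A B, r A B} -> {in compress i F &, forall A B, r A B}.
Proof.
move=> rF A' B' /imsetP[A AF ->] /imsetP[B BF ->].
have mixed C D : C \in F -> D \in F -> P i C ->
    ~~ (P i D && (phi i D \notin F)) -> r (phi i C) D.
  move=> CF DF PC; rewrite negb_and negbK; case: (boolP (P i D)) => /= [PD pDF|nPD _].
    by apply: r_swap => //; apply: rF.
  by apply: r_left => //; apply: rF.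
case: ifP => [/andP[PA nA]|/negbT nA]; case: ifP => [/andP[PB nB]|/negbT nB].
- by apply: r_both => //; apply: rF.
- exact: mixed.
- by rewrite r_sym; apply: mixed.
- exact: rF.
Qed.

Lemma compress_weight i (F : {set T}) A :
  A \in F -> P i A -> phi i A \notin F ->
  \sum_(B in compress i F) w B < \sum_(B in F) w B.
Proof.
move=> AF PA nA; rewrite big_imset; last exact: compress_inj.
rewrite (bigD1 A) //= [X in _ < X](bigD1 A) //= PA nA /=.
rewrite -addSn leq_add ?w_phi //; apply: leq_sum => B _.
by case: ifP => // /andP[PB _]; exact/ltnW/w_phi.
Qed.

(** Compress while some member can still move; the total weight drops each time. *)
Lemma stable_family (F : {set T}) :
  {in F &, forall A B, r A B} ->
  exists G : {set T}, [/\ #|G| = #|F|, {in G &, forall A B, r A B}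
    & forall i A, A \in G -> P i A -> phi i A \in G].
Proof.
have [m] := ubnP (\sum_(B in F) w B); elim: m F => // m IH F lem rF.
have [/existsP[i /exists_inP[A AF /andP[PA nA]]]|stab] :=
  boolP [exists i, [exists A in F, P i A && (phi i A \notin F)]].
  have [|G [cG rG sG]] := IH (compress i F) _ (compress_rel rF).
    exact: leq_trans (compress_weight AF PA nA) _.
  by exists G; rewrite cG card_compress.
exists F; split=> // i A AF PA; apply: contraNT stab => nA.
by apply/existsP; exists i; apply/exists_inP; exists A => //; rewrite PA.
Qed.

End Compression.

(** * From agreeing sets to intersecting sets, and to left-shifted families *)

Section Reductions.
Local Open Scope nat_scope.
Local Open Scope set_scope.
Variable n : nat.
Implicit Types (A B : {set 'I_n}) (F : {set {set 'I_n}}).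

Definition agree A B : {set 'I_n} := [set x | (x \in A) == (x \in B)].

(* Replacing [B] by [B :|: ~: A], still a member of an up-closed family, turns
   the agreement set of [A] and [B] into [A :&: B]. *)
Lemma agreeing_to_intersecting F r :
  {in F &, forall A B, r <= #|agree A B|} ->
  exists G : {set {set 'I_n}},
    #|G| = #|F| /\ {in G &, forall A B, r <= #|A :&: B|}.
Proof.
move=> rF.
(* The move adds the point [i]; the weight counts the points still missing. *)
have [] := @stable_family _ _ (fun (i : 'I_n) A => i \notin A) (fun i A => i |: A)
  (fun A B => r <= #|agree A B|) (fun A => #|~: A|) _ _ _ _ _ _ F rF.
- move=> i A B nA nB /setP E; apply/setP => x; have := E x; rewrite !inE.
  by case: eqP => // -> _; rewrite (negbTE nA) (negbTE nB).
- move=> i A nA; apply/proper_card/properP; split.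
    by rewrite setCS subsetU1.
  by exists i; rewrite !inE ?nA ?eqxx.
- move=> A B; suff -> : agree A B = agree B A by [].
  by apply/setP => x; rewrite !inE eq_sym.
- move=> i A B nA nB /leq_trans; apply; apply/subset_leq_card/subsetP => x.
  by rewrite !inE; case: (eqVneq x i) => // ->; rewrite (negbTE nA) (negbTE nB).
- move=> i A B nA nB /leq_trans; apply; apply/subset_leq_card/subsetP => x.
  rewrite !inE; case: (eqVneq x i) => // -> _.
  by move: nB; rewrite negbK (negbTE nA) => ->.
- move=> i A B nA nB /leq_trans; apply; apply/subset_leq_card/subsetP => x.
  by rewrite !inE; case: (eqVneq x i) => // ->; rewrite (negbTE nA).
move=> G [cG rG sG]; exists G; split=> // A B AG BG.
(* Stability under adding single points makes [G] up-closed. *)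
have up s C : C \in G -> C :|: [set:: s] \in G.
  elim: s C => [|x s IH] C CG; first by rewrite set_nil setU0.
  rewrite set_cons setUA [C :|: _]setUC; apply: IH.
  by case: (boolP (x \in C)) => [xC|]; [rewrite (setUidPr _) ?sub1set | exact: sG].
have /(rG _ _ AG) : B :|: ~: A \in G.
  suff -> : ~: A = [set:: enum (~: A)] by exact: up.
  by apply/setP => x; rewrite inE mem_enum.
move/leq_trans; apply; apply/subset_leq_card/subsetP => x.
by rewrite !inE; case: (x \in A); case: (x \in B).
Qed.

Definition left_shifted F := forall i j : 'I_n, i < j ->
  forall A, A \in F -> j \in A -> i \notin A -> i |: (A :\ j) \in F.

Lemma shifted_family F r :
  {in F &, forall A B, r <= #|A :&: B|} ->
  exists G : {set {set 'I_n}}, [/\ #|G| = #|F|,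
     {in G &, forall A B, r <= #|A :&: B|} & left_shifted G].
Proof.
move=> rF.
(* The move replaces [j] by the smaller [i]; the weight is the sum of the points. *)
have [] := @stable_family _ _
  (fun (ij : 'I_n * 'I_n) A => [&& ij.1 < ij.2, ij.2 \in A & ij.1 \notin A])
  (fun ij A => ij.1 |: (A :\ ij.2))
  (fun A B => r <= #|A :&: B|) (fun A => \sum_(x in A) x) _ _ _ _ _ _ F rF.
- move=> [i j] A B /and3P[/= ij jA iA] /and3P[_ jB iB] /setP E; apply/setP => x.
  have := E x; rewrite /= !inE; case: (eqVneq x j) => [->|]; first by rewrite jA jB.
  by case: (eqVneq x i) => // -> _; rewrite (negbTE iA) (negbTE iB).
- move=> [i j] A /and3P[/= ij jA iA].
  rewrite big_setU1 ?inE ?(negbTE iA) ?andbF //=.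
  by rewrite [X in _ < X](big_setD1 j jA) /= ltn_add2r.
- by move=> A B; rewrite setIC.
- move=> [i j] A B /and3P[/= _ jA iA] /and3P[_ jB iB] /leq_trans; apply.
  rewrite -setUIr -setDIl cardsU1 !inE (negbTE iA) andbF add1n.
  by rewrite [leqLHS](cardsD1 j) inE jA jB add1n.
(* If [j] is in [B], ineligibility puts [i] in [B] too, so the intersection trades [j] for [i];
   otherwise it loses nothing. *)
- move=> [i j] A B /and3P[/= ij jA iA] nB /leq_trans; apply.
  case: (boolP (j \in B)) => jB.
    have iB : i \in B by move: nB; rewrite ij jB /= negbK.
    have -> : (i |: A :\ j) :&: B = i |: ((A :&: B) :\ j).
      by apply/setP => x; rewrite !inE; case: eqP => [->|]; rewrite ?iB //= andbA.
    by rewrite cardsU1 !inE (negbTE iA) andbF add1n [leqLHS](cardsD1 j) inE jA jB add1n.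
  apply/subset_leq_card/subsetP => x; rewrite !inE => /andP[xA xB].
  by rewrite xA xB (memPn jB) ?orbT.
- move=> [i j] A B /and3P[/= _ jA iA] _ /leq_trans; apply.
  apply/subset_leq_card/subsetP => x; rewrite !inE => /andP[xA].
  by case: (eqVneq x i) xA => [->|_ xA]; [rewrite (negbTE iA) | move=> /= /andP[-> ->]; rewrite xA].
by move=> G [cG rG sG]; exists G; split=> // i j ij A AG jA iA; apply: (sG (i, j));
  rewrite // ij jA.
Qed.

End Reductions.

(** * Katona's shadow inequality for shifted families *)

Section Katona.
Local Open Scope nat_scope.
Local Open Scope set_scope.
Variable n : nat.
Implicit Types (A B C : {set 'I_n}) (F : {set {set 'I_n}}).

Definition below A (j : nat) : {set 'I_n} := [set x in A | x < j].

Lemma card_belowS A (j : 'I_n) : #|below A j.+1| = (j \in A) + #|below A j|.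
Proof.
rewrite (cardsD1 j) !inE ltnSn andbT; congr (_ + #|pred_of_set _|).
apply/setP => x; rewrite !inE ltnS leq_eqVlt -val_eqE /=.
by case: ltngtP; rewrite ?andbF ?andbT.
Qed.

Lemma below_all A j : n <= j -> below A j = A.
Proof.
by move=> nj; apply/setP => x; rewrite inE (leq_trans (ltn_ord x) nj) andbT.
Qed.

Lemma card_below A j : #|below A j| <= j.
Proof.
elim: j => [|j IH].
  by rewrite leqn0 cards_eq0; apply/eqP/setP => x; rewrite !inE andbF.
have [jn|nj] := ltnP j n.
  by rewrite (card_belowS A (Ordinal jn)) -[j.+1]add1n leq_add ?leq_b1.
by rewrite below_all ?(leqW nj) // -(below_all A nj) leqW.
Qed.

(** Shifts move [A] to [B] point by point: the least point [y] of [A] outside [B] is replaced by the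
    least point [x] of [B] outside [A]. Domination gives [x < y], and the exchange preserves
    domination and shrinks [B :\: A]. *)
Lemma shifted_dominated F A B :
  left_shifted F -> A \in F -> #|B| = #|A| ->
  (forall j, j <= n -> #|below A j| <= #|below B j|) -> B \in F.
Proof.
move=> sF; have [m] := ubnP #|B :\: A|; elim: m A => // m IH A lem AF cBA dom.
have [BA|/set0Pn[z zBA]] := boolP (B :\: A == set0).
  rewrite setD_eq0 in BA; suff <- : A = B by [].
  by apply/esym/eqP; rewrite eqEcard BA cBA leqnn.
have /set0Pn[z' zAB] : A :\: B != set0.
  rewrite -card_gt0; have := cardsID B A; have := cardsID A B.
  rewrite setIC cBA; move/eqP; rewrite -[X in _ == X](cardsID B A) eqn_add2l => /eqP <- _.
  by rewrite card_gt0; apply/set0Pn; exists z.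
have [y yAB ymin] := arg_minnP (P := mem (A :\: B)) (fun x : 'I_n => val x) zAB.
have [x xBA xmin] := arg_minnP (P := mem (B :\: A)) (fun x : 'I_n => val x) zBA.
have /setDP[yA yB] : y \in A :\: B := yAB.
have /setDP[xB xA] : x \in B :\: A := xBA.
have belowAB j : j <= y -> below A j \subset below B j.
  move=> jy; apply/subsetP => u; rewrite !inE => /andP[uA uj]; rewrite uj andbT.
  apply: contraLR uj => uB; rewrite -leqNgt (leq_trans jy) //.
  by apply: ymin; rewrite /= inE uA uB.
have xy : x < y.
  rewrite ltnNge; apply/negP => yx.
  have := dom y.+1 (ltn_ord y); rewrite !card_belowS yA (negbTE yB).
  suff /subset_leq_card : below B y \subset below A y by lia.
  apply/subsetP => u; rewrite !inE => /andP[uB uy]; rewrite uy andbT.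
  apply: contraLR uy => uA; rewrite -leqNgt (leq_trans yx) //.
  by apply: xmin; rewrite /= inE uA uB.
have xAy : x \notin A :\ y by rewrite inE (negbTE xA) andbF.
apply: (IH (x |: (A :\ y))).
- rewrite -ltnS; apply: leq_trans lem; rewrite ltnS; apply/proper_card/properP; split.
    apply/subsetP => u; rewrite !inE => /andP[nu uB]; rewrite uB andbT.
    apply: contra nu => uA; rewrite uA andbT orbC.
    by apply/orP; left; apply: contraNneq yB => <-.
  by exists x => //; rewrite !inE eqxx.
- exact: sF.
- by rewrite cBA cardsU1 xAy [LHS](cardsD1 y) yA.
(* Only prefixes that contain [x] but not [y] gain a point, and there the new set lies within [B] by
   minimality of [y]. *)
move=> j jn; case: (leqP j y) => [jy|yj].
  case: (leqP j x) => [jx|xj].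
    apply: leq_trans (dom _ jn); apply/subset_leq_card/subsetP => u.
    rewrite !inE => /andP[/orP[/eqP ->|/andP[_ ->]] //].
    by rewrite ltnNge jx.
  apply: subset_leq_card; apply/subsetP => u; rewrite !inE.
  case: eqP => [-> _|_ /= /andP[/andP[_ uA] uj]]; first by rewrite xB.
  by have /subsetP/(_ u) := belowAB j jy; rewrite !inE uA uj; apply.
apply: leq_trans (dom _ jn).
have -> : below (x |: A :\ y) j = x |: (below A j :\ y).
  apply/setP => u; rewrite !inE; case: eqP => [->|_] /=.
    by rewrite (ltn_trans xy yj).
  by rewrite andbA.
rewrite cardsU1 !inE (negbTE xA) /= andbF /= [leqRHS](cardsD1 y) !inE yA yj.
by [].
Qed.

(* Otherwise [A] could be shifted to both [{0, 2, 4, ...}] and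
   [{0, 1, 3, 5, ...}], which share only one point. *)
Lemma shifted_majority F A :
  left_shifted F -> {in F &, forall A B, 2 <= #|A :&: B|} -> A \in F ->
  exists i : 'I_n, i + 2 <= #|below A (i.*2 + 2)|.
Proof.
move=> sF F2 AF; apply/existsP; apply: contraT; rewrite negb_exists => /forallP low.
have A2 : 2 <= #|A| by rewrite -[A]setIid F2.
(* The negated conclusion bounds the even prefixes; an odd prefix adds at most one point to the even
   one before it. *)
have bound j : j <= n -> #|below A j| <= uphalf j.
  elim/ltn_ind: j => -[|[|j]] IH jn.
  - by rewrite leqn0 cards_eq0; apply/eqP/setP => x; rewrite !inE andbF.
  - rewrite (card_belowS A (Ordinal jn)) -[uphalf 1]/(1 + 0).
    by rewrite leq_add ?leq_b1 ?(IH 0) ?(ltnW jn).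
  case: (boolP (odd j)) => oj.
    have := IH j.+1 (leqnn _) (ltnW jn).
    rewrite (card_belowS A (Ordinal jn)) /=.
    case: (_ \in A) => /=; lia.
  have hj : j./2 < n by lia.
  have := low (Ordinal hj); rewrite /= -ltnNge.
  have -> : j./2.*2 + 2 = j.+2 by lia.
  rewrite uphalf_half (negbTE oj); lia.
(* The cutoff [#|A|.*2.-1] leaves exactly [#|A|] points in each of [C] and [D]. *)
pose C := [set x : 'I_n | ~~ odd x & x < #|A|.*2.-1].
pose D := [set x : 'I_n | (x == 0 :> nat) || odd x & x < #|A|.*2.-1].
have card_n : #|A| <= uphalf n by rewrite -{1}(below_all A (leqnn n)) bound.
have belowC j : j <= n -> #|below C j| = minn #|A| (uphalf j).
  elim: j => [_|j IH jn].
    by rewrite minn0; apply/eqP; rewrite cards_eq0; apply/eqP/setP => x; rewrite !inE andbF.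
  rewrite (card_belowS C (Ordinal jn)) IH ?(ltnW jn) // !inE /=.
  case: (boolP (odd j)) => oj /=; case: ltnP; lia.
have belowD j : j <= n -> #|below D j| = minn #|A| ((0 < j) + j./2).
  elim: j => [_|j IH jn].
    by rewrite minn0; apply/eqP; rewrite cards_eq0; apply/eqP/setP => x; rewrite !inE andbF.
  rewrite (card_belowS D (Ordinal jn)) IH ?(ltnW jn) // !inE /=.
  case: (boolP (odd j)) => oj /=; case: eqP => ej; case: ltnP => /=; lia.
have belowA j : #|below A j| <= #|A|.
  by apply/subset_leq_card/subsetP => x; rewrite inE => /andP[].
have CF : C \in F.
  apply: shifted_dominated sF AF _ _ => [|j jn].
    by rewrite -(below_all C (leqnn n)) belowC //; lia.
  by rewrite belowC // leq_min belowA bound.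
have DF : D \in F.
  apply: shifted_dominated sF AF _ _ => [|j jn].
    by rewrite -(below_all D (leqnn n)) belowD //; lia.
  rewrite belowD // leq_min belowA /=; apply: leq_trans (bound j jn) _.
  by case: (j) => //= i; lia.
have := F2 _ _ CF DF; rewrite leqNgt => /negP[].
rewrite ltnS; apply/card_le1_eqP => x y; rewrite !inE => /and3P[/andP[ox _] + _].
rewrite (negbTE ox) orbF => /eqP x0 /and3P[/andP[oy _] + _].
by rewrite (negbTE oy) orbF => /eqP y0; apply/val_inj; rewrite /= x0 y0.
Qed.

Definition shadow F : {set {set 'I_n}} :=
  [set B | [exists A in F, exists x in A, B == A :\ x]].

(** The last prefix of length [i.*2 + 2] holding at least [i + c] points. Members of the family use
    [c = 2], sets of the shadow [c = 1]. Being last, it assigns each set at most one [i]. *)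
Definition last_level (c : nat) A (i : 'I_n) : bool :=
  (i + c <= #|below A (i.*2 + 2)|) &&
  [forall j : 'I_n, (i < j) ==> (#|below A (j.*2 + 2)| < j + c)].

Lemma last_levelW c A (i : 'I_n) :
  i + c <= #|below A (i.*2 + 2)| -> exists j, last_level c A j.
Proof.
move=> Pi; pose P (j : 'I_n) := j + c <= #|below A (j.*2 + 2)|.
have [j Pj jmax] := arg_maxnP (P := P) (fun x : 'I_n => val x) Pi.
exists j; apply/andP; split=> //; apply/forallP => l; apply/implyP => jl.
by rewrite ltnNge; apply: contraTN jl => /jmax /=; rewrite -leqNgt.
Qed.

Lemma last_level_uniq c A (i j : 'I_n) :
  last_level c A i -> last_level c A j -> i = j.
Proof.
move=> /andP[Pi /forallP Mi] /andP[Pj /forallP Mj]; apply/val_inj => /=.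
have := Mi j; have := Mj i.
by case: ltngtP => //= _; rewrite ltnNge ?Pi ?Pj.
Qed.

(** Deleting a point of this prefix lowers its count and that of every longer prefix by exactly one,
    so [i] remains last. *)
Lemma last_level_del A (i x : 'I_n) :
  x \in A -> x < i.*2 + 2 -> last_level 2 A i -> last_level 1 (A :\ x) i.
Proof.
move=> xA xi /andP[Pi /forallP Mi].
have del j : x < j -> #|below A j| = #|below (A :\ x) j|.+1.
  move=> xj; rewrite (cardsD1 x) inE xA xj; congr (_.+1); apply: eq_card => u.
  by rewrite !inE andbA.
apply/andP; split; first by rewrite del // addnS ltnS in Pi.
apply/forallP => j; apply/implyP => ij; have := Mi j.
by rewrite ij /= del ?addnS ?ltnS //; lia.
Qed.

(* Double count the pairs [(A, x)] with [x] in [A] below [i.*2 + 2]. *)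
Lemma shadow_level F (i : 'I_n) :
  (i + 2) * #|[set A in F | last_level 2 A i]|
  <= (i + 1) * #|[set B in shadow F | last_level 1 B i]|.
Proof.
pose E := [set u : {set 'I_n} * 'I_n |
  [&& u.1 \in F, last_level 2 u.1 i & u.2 \in below u.1 (i.*2 + 2)]].
(* Pairs of a shadow set and a hole of its prefix: at least [i + 1] of the [i.*2 + 2] places are
   filled, so at most [i + 1] are holes. Sending [(A, x)] to [(A :\ x, x)] embeds [E] here. *)
pose E' := [set u : {set 'I_n} * 'I_n |
  [&& u.1 \in shadow F, last_level 1 u.1 i & (u.2 \notin u.1) && (u.2 < i.*2 + 2)]].
have cE : (i + 2) * #|[set A in F | last_level 2 A i]| <= #|E|.
  rewrite -[leqRHS]sum1_card.
  rewrite (partition_big fst (mem [set A in F | last_level 2 A i])) /=; last first.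
    by move=> u; rewrite !inE => /and3P[-> ->].
  rewrite mulnC -sum_nat_const; apply: leq_sum => A; rewrite inE => /andP[AF lA].
  have /andP[Pi _] := lA; apply: (leq_trans Pi); rewrite -sum1_card.
  rewrite (reindex_onto (pair A) snd) /=; last by move=> [? ?] /andP[_ /= /eqP <-].
  by apply: eq_leq; apply: eq_bigl => x; rewrite !inE /= AF lA !eqxx !andbT.
apply: leq_trans cE _; apply: (@leq_trans #|E'|).
  rewrite -(@card_in_imset _ _ (fun u : {set 'I_n} * 'I_n => (u.1 :\ u.2, u.2)) E).
    apply/subset_leq_card/subsetP => _ /imsetP[[A x] + ->]; rewrite !inE /=.
    move=> /and4P[AF lA xA xi]; rewrite eqxx xi last_level_del //= andbT.
    by apply/exists_inP; exists A => //; apply/exists_inP; exists x.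
  move=> [A x] [B y]; rewrite !inE /= => /and4P[_ _ xA _] /and4P[_ _ yB _] [E1 E2].
  by rewrite -(setD1K xA) -(setD1K yB) E1 E2.
rewrite -[leqLHS]sum1_card.
rewrite (partition_big fst (mem [set B in shadow F | last_level 1 B i])) /=; last first.
  by move=> u; rewrite !inE => /and3P[-> ->].
rewrite mulnC -sum_nat_const; apply: leq_sum => B; rewrite inE => /andP[BF lB].
rewrite (reindex_onto (pair B) snd) /=; last by move=> [? ?] /andP[_ /= /eqP <-].
rewrite (eq_bigl (mem ([set x : 'I_n | x < i.*2 + 2] :\: B))); last first.
  by move=> x; rewrite !eqxx !andbT [in LHS]inE /= BF lB !inE.
rewrite sum1_card cardsD.
have -> : [set x : 'I_n | x < i.*2 + 2] = below setT (i.*2 + 2).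
  by apply/setP => x; rewrite !inE.
have -> : below setT (i.*2 + 2) :&: B = below B (i.*2 + 2).
  by apply/setP => x; rewrite !inE andbC.
have /andP[Pi _] := lB; apply: leq_trans (leq_sub (card_below _ _) Pi) _; lia.
Qed.

Definition level k F := [set A in F | #|A| == k].

(** Every member has a last level by [shifted_majority], so [shadow_level] can be summed over [i]. A
    nonempty class has [i + 2 <= k], whence the ratio [(i + 2) / (i + 1)] is at least
    [k / (k - 1)]. *)
Lemma shadow_bound F k :
  left_shifted F -> {in F &, forall A B, 2 <= #|A :&: B|} ->
  k * #|level k F| <= k.-1 * #|shadow (level k F)|.
Proof.
move=> sF F2.
pose f i := #|[set A in level k F | last_level 2 A i]|.
pose g i := #|[set B in shadow (level k F) | last_level 1 B i]|.
have lef : #|level k F| <= \sum_(i < n) f i.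
  rewrite -sum1_card; under [leqRHS]eq_bigr do rewrite /f -sum1_card big_mkcond /=.
  rewrite exchange_big /= [leqRHS](bigID (mem (level k F))) /= -[leqLHS]addn0 leq_add //.
  apply: leq_sum => A Ak; have := Ak; rewrite inE => /andP[AF _].
  have [i /last_levelW[j lj]] := shifted_majority sF F2 AF.
  by rewrite (bigD1 j) //= inE Ak lj.
have leg : \sum_(i < n) g i <= #|shadow (level k F)|.
  rewrite -sum1_card; under [leqLHS]eq_bigr do rewrite /g -sum1_card big_mkcond /=.
  rewrite exchange_big /= [leqRHS]big_mkcond; apply: leq_sum => B _.
  case: (boolP [exists j, last_level 1 B j]) => [/existsP[j lj]|].
    rewrite (bigD1 j) //= inE lj andbT big1 ?addn0 // => i ij.
    by rewrite inE; case: ifP => // /andP[_ li]; rewrite (last_level_uniq li lj) eqxx in ij.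
  rewrite negb_exists => /forallP nl; rewrite big1 // => i _.
  by rewrite inE (negbTE (nl i)) andbF.
apply: leq_trans (leq_mul (leqnn _) lef) (leq_trans _ (leq_mul (leqnn _) leg)).
rewrite !big_distrr /=; apply: leq_sum => i _.
have [f0|/set0Pn[A]] := eqVneq [set A in level k F | last_level 2 A i] set0.
  by rewrite /f f0 cards0 muln0.
rewrite !inE => /andP[/andP[_ /eqP Ak] /andP[Pi _]].
have i2k : i + 2 <= k.
  by rewrite -Ak (leq_trans Pi) // subset_leq_card //; apply/subsetP => x; rewrite inE => /andP[].
have := shadow_level (level k F) i; rewrite -/(f i) -/(g i) => sl.
rewrite -(leq_pmul2l (_ : 0 < i + 1)) ?addn1 //; rewrite addn1 in sl.
apply: leq_trans (_ : k.-1 * ((i + 2) * f i) <= _); last first.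
  by rewrite [leqRHS]mulnCA leq_mul2l sl orbT.
rewrite !mulnA leq_mul2r; apply/orP; right; nia.
Qed.

(** Complements of sets of size [n.+1 - k] have [k.-1] points, like the sets of the shadow, and are
    disjoint from it: [~: D = A :\ x] would leave at most [x] in [A :&: D]. *)
Lemma shadow_compl F k :
  {in F &, forall A B, 2 <= #|A :&: B|} -> 0 < k <= n ->
  #|shadow (level k F)| + #|level (n.+1 - k) F| <= 'C(n, k.-1).
Proof.
move=> F2 /andP[k0 kn].
rewrite -(card_imset (level _ F) (can_inj (@setCK _))) -cardsUI.
rewrite [X in _ + X](_ : _ = 0) ?addn0; last first.
  apply/eqP; rewrite cards_eq0 -subset0; apply/subsetP => B; rewrite inE => /andP[].
  rewrite inE => /exists_inP[A]; rewrite inE => /andP[AF _] /exists_inP[x xA /eqP eB].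
  case/imsetP=> D; rewrite inE => /andP[DF _] eD.
  have := F2 _ _ AF DF; suff /subset_leq_card : A :&: D \subset [set x].
    by rewrite cards1 leqNgt => /negbTE ->.
  apply/subsetP => y; rewrite !inE => /andP[yA]; apply: contraTT => yx.
  by rewrite -in_setC -eD eB !inE yx.
rewrite -[n in 'C(n, _)]card_ord -card_draws; apply/subset_leq_card/subsetP => B.
rewrite !inE => /orP[/exists_inP[A]|/imsetP[A + ->]].
  rewrite inE => /andP[_ /eqP cA] /exists_inP[x xA /eqP ->].
  by rewrite -cA (cardsD1 x A) xA.
by rewrite inE => /andP[_ /eqP cA]; rewrite cardsCs setCK card_ord cA; apply/eqP; lia.
Qed.

Lemma level_pair F k :
  left_shifted F -> {in F &, forall A B, 2 <= #|A :&: B|} -> 0 < k <= n ->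
  #|level k F| + #|level (n.+1 - k) F| <= 'C(n, k.-1).
Proof.
move=> sF F2 kn; apply: leq_trans (shadow_compl F2 kn); rewrite leq_add2r.
have /andP[k0 _] := kn; rewrite -(leq_pmul2l k0).
by apply: leq_trans (shadow_bound k sF F2) _; rewrite leq_mul2r leq_pred orbT.
Qed.

Lemma card_levels F : {in F &, forall A B, 2 <= #|A :&: B|} ->
  #|F| = \sum_(k < n) #|level k.+1 F|.
Proof.
move=> F2; have l0 : level 0 F = set0.
  apply/setP => A; rewrite !inE; apply/negP => /andP[AF].
  by rewrite cards_eq0 => /eqP A0; have := F2 _ _ AF AF; rewrite A0 set0I cards0.
transitivity (\sum_(k < n.+1) #|level k F|); last first.
  by rewrite big_ord_recl l0 cards0.
rewrite -sum1_card (partition_big (fun A => inord #|A| : 'I_n.+1) predT) //=.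
apply: eq_bigr => k _; rewrite -sum1_card; apply: eq_bigl => A.
rewrite inE -val_eqE /= inordK // ltnS -[leqRHS]card_ord; exact: max_card.
Qed.

End Katona.

(** * Katona's bounds for 2-intersecting families *)

Lemma sum_reflect_even (f : nat -> nat) m :
  \sum_(k < m.*2) f k = \sum_(k < m) (f k + f (m.*2 - k.+1)).
Proof.
rewrite big_split /= -addnn big_split_ord /=; congr (_ + _).
rewrite (reindex_inj rev_ord_inj) /=; apply: eq_bigr => k _; congr f.
by have := ltn_ord k; lia.
Qed.

Lemma sum_reflect_odd (f : nat -> nat) m :
  \sum_(k < m.*2.+1) f k = \sum_(k < m) (f k + f (m.*2 - k)) + f m.
Proof.
rewrite big_split /= -addnn -addnS big_split_ord /= -addnA; congr (_ + _).
rewrite (reindex_inj rev_ord_inj) /= big_ord_recr /= addnC subnn addn0 addnC.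
congr (_ + _); apply: eq_bigr => k _; congr f.
by have := ltn_ord k; lia.
Qed.

(** The levels [k + 1] and [2m - k] are bounded together by [level_pair], and these pairs exhaust
    all levels. *)
Lemma katona_even m (F : {set {set 'I_m.*2}}) :
  {in F &, forall A B : {set 'I_m.*2}, 2 <= #|A :&: B|} ->
  #|F| <= \sum_(k < m) 'C(m.*2, k).
Proof.
move=> /shifted_family[G [<- G2 sG]].
rewrite (card_levels G2) (sum_reflect_even (fun k => #|level k.+1 G|)).
apply: leq_sum => k _; have km := ltn_ord k.
have := @level_pair _ G k.+1 sG G2; rewrite [_.-1]/=.
have -> : (m.*2.+1 - k.+1) = (m.*2 - k.+1).+1 by lia.
by apply; lia.
Qed.

(** Now the level [m + 1] is its own partner. For it the full ratio of [shadow_bound] is used: with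
    level size [f] and shadow size [s], [(m + 1) f <= m s] and [s + f <= 'C(2m + 1, m)] give
    [(2m + 1) f <= m 'C(2m + 1, m)]. *)
Lemma katona_odd m (F : {set {set 'I_m.*2.+1}}) : 0 < m ->
  {in F &, forall A B : {set 'I_m.*2.+1}, 2 <= #|A :&: B|} ->
  #|F| <= \sum_(k < m) 'C(m.*2.+1, k) + 'C(m.*2, m.-1).
Proof.
move=> m0 /shifted_family[G [<- G2 sG]].
rewrite (card_levels G2) (sum_reflect_odd (fun k => #|level k.+1 G|)).
apply: leq_add.
  apply: leq_sum => k _; have km := ltn_ord k.
  have := @level_pair _ G k.+1 sG G2; rewrite [_.-1]/=.
  have -> : (m.*2.+2 - k.+1) = (m.*2 - k).+1 by lia.
  by apply; lia.
have := shadow_bound m.+1 sG G2.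
have /= := @shadow_compl _ G m.+1 G2.
have -> : (m.*2.+2 - m.+1) = m.+1 by lia.
have := mul_bin_diag m.*2.+1 m.-1; rewrite /= prednK //.
set s := #|shadow _|; set f := #|level _ _| => h1 h2 h3.
have {}h2 : s + f <= 'C(m.*2.+1, m) by apply: h2; lia.
rewrite -(leq_pmul2l (_ : 0 < m.*2.+1)) // h1; nia.
Qed.

(** * Matching families of words *)

Section MaxWords.
Local Open Scope nat_scope.
Local Open Scope set_scope.

(** Restricting to [S] and enumerating its points turns sets into words of length [#|S|]. It serves
    both the extremal examples and the sign patterns with a given support. *)
Lemma leq_max_words (T : finType) (S : {set T}) (G : {set {set T}}) r :
  {in G, forall A : {set T}, A \subset S} ->
  {in G &, forall A B : {set T}, A != B ->
     r <= #|[set x in S | (x \in A) == (x \in B)]|} ->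
  #|G| <= max_words #|S| r.
Proof.
move=> GS rG; pose word (A : {set T}) := [tuple enum_val i \in A | i < #|S|].
have word_inj : {in G &, injective word}.
  move=> A B /GS/subsetP AS /GS/subsetP BS E; apply/setP => x.
  have [xS|xS] := boolP (x \in S); last first.
    by rewrite (contraNF (AS x) xS) (contraNF (BS x) xS).
  have := congr1 (fun u => tnth u (enum_rank_in xS x)) E.
  by rewrite !tnth_mktuple enum_rankK_in.
rewrite -(card_in_imset word_inj); apply: leq_bigmax_cond.
apply/forall_inP => _ /imsetP[A AG ->]; apply/forall_inP => _ /imsetP[B BG ->].
apply/implyP => nAB; have {}nAB : A != B by apply: contraNneq nAB => ->.
apply: leq_trans (rG _ _ AG BG nAB) _.
rewrite /matches -(card_imset _ enum_val_inj); apply/subset_leq_card/subsetP => x.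
rewrite inE => /andP[xS xAB]; apply/imsetP; exists (enum_rank_in xS x).
  by rewrite inE !tnth_mktuple enum_rankK_in.
by rewrite enum_rankK_in.
Qed.

Lemma max_words_family k r : exists F : {set {set 'I_k}},
  #|F| = max_words k r /\ {in F &, forall A B : {set 'I_k}, A != B -> r <= #|agree A B|}.
Proof.
have [|W mW maxW] := @eq_bigmax_cond _ (matching_family r) (fun W : {set k.-tuple bool} => #|W|).
  apply/card_gt0P; exists set0; rewrite unfold_in; apply/forall_inP => u.
  by rewrite inE.
pose s (u : k.-tuple bool) := [set i | tnth u i].
have s_inj : injective s.
  by move=> u v /setP E; apply: eq_from_tnth => i; have := E i; rewrite !inE.
exists (s @: W); split; first by rewrite card_imset // -maxW.
move=> _ _ /imsetP[u uW ->] /imsetP[v vW ->] nuv.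
have {}nuv : u != v by apply: contraNneq nuv => ->.
have /forall_inP/(_ u uW)/forall_inP/(_ v vW)/implyP/(_ nuv)/leq_trans := mW; apply.
by apply/subset_leq_card/subsetP => i; rewrite !inE.
Qed.

Lemma matching_to_intersecting n r (F : {set {set 'I_n}}) : r <= n ->
  {in F &, forall A B : {set 'I_n}, A != B -> r <= #|agree A B|} ->
  exists G : {set {set 'I_n}},
    #|G| = #|F| /\ {in G &, forall A B, r <= #|A :&: B|}.
Proof.
move=> rn rF; apply: agreeing_to_intersecting => A B AF BF.
(* A set agrees with itself in all [n] places, which covers the diagonal since [r <= n]. *)
have [->|] := eqVneq A B; last exact: rF.
by rewrite (_ : agree B B = setT) ?cardsT ?card_ord //; apply/setP => x; rewrite !inE eqxx.
Qed.

(** All points outside [A :|: B] are agreements, so small sets agree often. *)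
Lemma card_agree_ge n (A B : {set 'I_n}) :
  n + #|A :&: B| <= #|A| + #|B| + #|agree A B|.
Proof.
rewrite -cardsUI -addnA [_ + #|agree _ _|]addnC addnA leq_add2r.
rewrite -{1}[n]card_ord -cardsT (leq_trans _ (leq_card_setU _ _)) // subset_leq_card //.
by apply/subsetP => x _; rewrite !inE; case: (x \in A); case: (x \in B).
Qed.

Lemma card_small_sets (T : finType) m :
  #|[set A : {set T} | #|A| < m]| = \sum_(k < m) 'C(#|T|, k).
Proof.
elim: m => [|m IH]; first by rewrite big_ord0; apply/eqP; rewrite cards_eq0;
  apply/eqP/setP => A; rewrite !inE.
rewrite big_ord_recr /= -IH -card_draws -cardsUI [X in _ + X](_ : _ = 0) ?addn0; last first.
  by apply/eqP; rewrite cards_eq0; apply/eqP/setP => A; rewrite !inE; case: ltngtP.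
by congr (#|pred_of_set _|); apply/setP => A; rewrite !inE ltnS leq_eqVlt orbC.
Qed.

(** The sets with fewer than [m] points attain Katona's bound. *)
Lemma max_words_even m : 0 < m -> max_words m.*2 2 = \sum_(k < m) 'C(m.*2, k).
Proof.
move=> m0; apply/eqP; rewrite eqn_leq; apply/andP; split.
  have [F [<- /matching_to_intersecting[|G [<- G2]]]] := max_words_family m.*2 2.
    by lia.
  exact: katona_even.
have -> : \sum_(k < m) 'C(m.*2, k) = #|[set A : {set 'I_m.*2} | #|A| < m]|.
  by rewrite card_small_sets card_ord.
rewrite -[m.*2 in leqRHS]card_ord -cardsT.
apply: leq_max_words => [A _|A B]; first exact: subsetT.
rewrite !inE => Am Bm _.
rewrite (_ : [set x in _ | _] = agree A B); last by apply/setP => x; rewrite !inE.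
have := card_agree_ge A B; lia.
Qed.

(** The extremal family adds to the sets below size [m] those of size [m] through [ord0]; two of the
    latter share [ord0], which supplies the second agreement. *)
Lemma max_words_odd m : 0 < m ->
  max_words m.*2.+1 2 = \sum_(k < m) 'C(m.*2.+1, k) + 'C(m.*2, m.-1).
Proof.
move=> m0; apply/eqP; rewrite eqn_leq; apply/andP; split.
  have [F [<- /matching_to_intersecting[|G [<- G2]]]] := max_words_family m.*2.+1 2.
    by lia.
  exact: katona_odd.
pose P := [set A : {set 'I_m.*2.+1} | (ord0 \in A) && (#|A| == m)].
have -> : \sum_(k < m) 'C(m.*2.+1, k) + 'C(m.*2, m.-1)
    = #|[set A : {set 'I_m.*2.+1} | #|A| < m] :|: P|.
  have -> : \sum_(k < m) 'C(m.*2.+1, k) = #|[set A : {set 'I_m.*2.+1} | #|A| < m]|.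
    by rewrite card_small_sets card_ord.
  have disj : #|[set A : {set 'I_m.*2.+1} | #|A| < m] :&: P| = 0.
    apply/eqP; rewrite cards_eq0; apply/eqP/setP => A; rewrite !inE.
    by case: ltngtP; rewrite ?andbF.
  rewrite -[RHS]addn0 -disj cardsUI; congr (_ + _); apply/eqP.
  have cm := card_draws 'I_m.*2.+1 m; have c0 := cards_draws [set~ ord0 : 'I_m.*2.+1] m.
  rewrite -(cardsID P) card_ord in cm; rewrite cardsC1 card_ord /= in c0.
  have binm : 'C(m.*2.+1, m) = 'C(m.*2, m) + 'C(m.*2, m.-1).
    by case: (m) m0 => // k; rewrite -binS.
  move: cm; rewrite binm addnC -c0 => /eqP.
  rewrite (_ : _ :\: P = [set A : {set 'I_m.*2.+1} | A \subset [set~ ord0] & #|A| == m]).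
    rewrite eqn_add2l eq_sym (_ : _ :&: P = P) //.
    by apply/setP => A; rewrite !inE andbCA andbb.
  apply/setP => A; rewrite !inE subsetC sub1set inE.
  by case: (ord0 \in A); case: (_ == m).
rewrite -[m.*2.+1 in leqRHS]card_ord -cardsT.
apply: leq_max_words => [A _|A B]; first exact: subsetT.
rewrite !inE => Am Bm nAB.
rewrite (_ : [set x in _ | _] = agree A B); last by apply/setP => x; rewrite !inE.
have := card_agree_ge A B.
case/orP: Am => [Am|/andP[A0 /eqP Am]]; case/orP: Bm => [Bm|/andP[B0 /eqP Bm]]; try lia.
suff : 0 < #|A :&: B| by lia.
by apply/card_gt0P; exists ord0; rewrite inE A0.
Qed.

(** Kleitman's value, freed of subtraction and halving: by symmetry the binomials below the middle
    make up half of all but the central one. *)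
Lemma max_words_even_closed m : 0 < m ->
  max_words m.*2 2 * 2 + 'C(m.*2, m) = 2 ^ m.*2.
Proof.
move=> m0; rewrite max_words_even // -[in RHS](addn1 1) expnDn.
under [RHS]eq_bigr do rewrite !exp1n !muln1.
rewrite sum_reflect_odd muln2 -addnn -big_split /=; congr (_ + _).
apply: eq_bigr => k _; rewrite bin_sub //; have := ltn_ord k; lia.
Qed.

(** Half of row [2m + 1] sums to [2 ^ m.*2], and Pascal's rule splits off the central binomial from
    its last term. *)
Lemma max_words_odd_closed m : 0 < m ->
  max_words m.*2.+1 2 + 'C(m.*2, m) = 2 ^ m.*2.
Proof.
move=> m0; rewrite max_words_odd //.
have : 2 ^ m.*2.+1 = \sum_(k < m.+1) 'C(m.*2.+1, k) * 2.
  rewrite -[in LHS](addn1 1) expnDn.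
  under [LHS]eq_bigr do rewrite !exp1n !muln1.
  rewrite (sum_reflect_even (fun k => 'C(m.*2.+1, k)) m.+1).
  apply: eq_bigr => k _; have := ltn_ord k => km.
  have -> : m.+1.*2 - k.+1 = m.*2.+1 - k by lia.
  rewrite bin_sub ?muln2 ?addnn //; lia.
rewrite -big_distrl big_ord_recr /= expnS.
have : 'C(m.*2.+1, m) = 'C(m.*2, m) + 'C(m.*2, m.-1) by case: m m0.
lia.
Qed.

End MaxWords.

(** * The bound as a power of three and sums of binomials *)

Section NbarClosed.
Local Open Scope nat_scope.

Lemma sum_even_odd (f : nat -> nat) m :
  \sum_(j < m.*2) f j = \sum_(k < m) f k.*2 + \sum_(k < m) f k.*2.+1.
Proof.
elim: m => [|m IH]; first by rewrite !big_ord0.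
by rewrite doubleS !big_ord_recr /= IH -addnA addnACA.
Qed.

Lemma max_words2 j :
  2 * max_words j.+2 2 + (if odd j then 2 * 'C(j.+1, j.+2./2) else 'C(j.+2, j.+2./2))
  = 2 ^ j.+2.
Proof.
have -> : j.+2./2 = (j./2).+1 by [].
rewrite -[in LHS](odd_double_half j) -[in RHS](odd_double_half j).
case: (odd j); rewrite ?add0n ?add1n /= odd_double ?doubleK ?uphalf_double /=.
  rewrite -!doubleS [in RHS]expnS -(@max_words_odd_closed (j./2).+1 isT); lia.
by rewrite -!doubleS -(@max_words_even_closed (j./2).+1 isT) mulnC.
Qed.

(** Reindexing by the number [j + 2] of nonzero coordinates. *)
Lemma Nbar_rev p :
  Nbar p.+2 = \sum_(j < p.+1) 'C(p.+2, j.+2) * max_words j.+2 2 + 2.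
Proof.
rewrite /Nbar big_mkord (reindex_inj rev_ord_inj) /=; congr (_ + _).
apply: eq_bigr => j _; have := ltn_ord j => jp.
have -> : p.+2 - (p.+1 - j.+1) = j.+2 by lia.
by rewrite -[in LHS]bin_sub; [congr ('C(_, _) * _); lia | lia].
Qed.

Lemma Nbar_sum p : 1 < p ->
  2 * Nbar p + \sum_(j < p.+1) 'C(p, j) *
     (if odd j then 2 * 'C(j.-1, j./2) else 'C(j, j./2)) = 3 ^ p + 4.
Proof.
case: p => [|[|p]] // _.
rewrite Nbar_rev.
have -> : 3 ^ p.+2 = \sum_(j < p.+3) 'C(p.+2, j) * 2 ^ j.
  by rewrite -[3]/(1 + 2) expnDn; apply: eq_bigr => j _; rewrite exp1n mul1n.
rewrite mulnDr big_distrr /= addnAC; congr (_ + _).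
have split (f : nat -> nat) : \sum_(j < p.+3) f j = f 0 + f 1 + \sum_(j < p.+1) f j.+2.
  by rewrite big_ord_recl big_ord_recl addnA.
rewrite (split (fun j => 'C(p.+2, j) * 2 ^ j)).
rewrite (split (fun j => 'C(p.+2, j) *
  (if odd j then 2 * 'C(j.-1, j./2) else 'C(j, j./2)))).
rewrite addnCA -big_split; congr (_ + _); apply: eq_bigr => j _.
by rewrite /= negbK -max_words2 mulnDr mulnCA.
Qed.

(** Of the two sums, over even and odd support sizes, the first becomes the 2F1 and the second the
    3F2. *)
Lemma Nbar_even l : 0 < l ->
  2 * Nbar l.*2 + \sum_(m < l.+1) 'C(l.*2, m.*2) * 'C(m.*2, m)
  + 2 * \sum_(m < l) 'C(l.*2, m.*2.+1) * 'C(m.*2, m) = 3 ^ l.*2 + 4.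
Proof.
move=> l0; rewrite -Nbar_sum; last by lia.
rewrite -[LHS]addnA; congr (_ + _).
rewrite [RHS]big_ord_recr [in LHS]big_ord_recr /= odd_double doubleK.
rewrite (sum_even_odd (fun j => 'C(l.*2, j) *
  (if odd j then 2 * 'C(j.-1, j./2) else 'C(j, j./2)))).
rewrite -[LHS]addnA -[RHS]addnA; congr (_ + _).
  by apply: eq_bigr => m _; rewrite odd_double doubleK.
rewrite addnC big_distrr /=; congr (_ + _).
by apply: eq_bigr => m _; rewrite odd_double /= uphalf_double mulnCA.
Qed.

Lemma Nbar_odd l : 0 < l ->
  2 * Nbar l.*2.+1 + \sum_(m < l.+1) 'C(l.*2.+1, m.*2) * 'C(m.*2, m)
  + 2 * \sum_(m < l.+1) 'C(l.*2.+1, m.*2.+1) * 'C(m.*2, m) = 3 ^ l.*2.+1 + 4.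
Proof.
move=> l0; rewrite -Nbar_sum; last by lia.
rewrite -[LHS]addnA; congr (_ + _).
rewrite -doubleS.
rewrite (sum_even_odd (fun j => 'C(l.*2.+1, j) *
  (if odd j then 2 * 'C(j.-1, j./2) else 'C(j, j./2)))).
congr (_ + _).
  by apply: eq_bigr => m _; rewrite odd_double doubleK.
rewrite big_distrr /=.
by apply: eq_bigr => m _; rewrite odd_double /= uphalf_double mulnCA.
Qed.

Lemma central_binS j : j.+1 * 'C(j.+1.*2, j.+1) = 2 * j.*2.+1 * 'C(j.*2, j).
Proof.
have := mul_bin_diag j.+1.*2 j; have := mul_bin_diag j.*2.+1 j.
rewrite doubleS /= -[in 'C(j.*2.+1, j.+1)]bin_sub; last by lia.
have -> : j.*2.+1 - j.+1 = j by lia.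
nia.
Qed.

End NbarClosed.

(** * Counting sign patterns by their supports *)

Section SignPatterns.
Local Open Scope nat_scope.
Local Open Scope set_scope.

Lemma sum_over_card (T : finType) (f : nat -> nat) :
  \sum_(A : {set T}) f #|A| = \sum_(k < #|T|.+1) 'C(#|T|, k) * f k.
Proof.
rewrite (partition_big (fun A : {set T} => inord #|A| : 'I_#|T|.+1) predT) //=.
apply: eq_bigr => k _; rewrite -card_draws -sum_nat_const.
apply: eq_big => [A|A]; last by move=> /eqP <-; rewrite inordK // ltnS max_card.
by rewrite inE -val_eqE /= inordK // ltnS max_card.
Qed.

(* A pair [(S, A)] with [A] contained in [S] encodes the sign vector that is
   positive on [A], negative on the rest of [S] and zero off [S]. *)
Lemma card_sign_patterns p (W : {set {set 'I_p} * {set 'I_p}}) : 1 < p ->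
  {in W, forall u : {set 'I_p} * {set 'I_p}, u.2 \subset u.1} ->
  {in W, forall u : {set 'I_p} * {set 'I_p}, u.1 != set0} ->
  {in W &, forall u v : {set 'I_p} * {set 'I_p}, #|u.1| = 1 -> #|v.1| = 1 -> u.1 = v.1} ->
  {in W &, forall u v : {set 'I_p} * {set 'I_p}, u.1 = v.1 -> u != v ->
     2 <= #|[set x in u.1 | (x \in u.2) == (x \in v.2)]|} ->
  #|W| < Nbar p.
Proof.
move=> p1 sub nonempty single match2.
pose W1 := [set u in W | #|u.1| == 1]; pose W2 := [set u in W | 1 < #|u.1|].
have W12 : #|W| <= #|W1| + #|W2|.
  apply: leq_trans (leq_card_setU _ _); apply/subset_leq_card/subsetP => u uW.
  by have := nonempty _ uW; rewrite !inE uW -card_gt0; case: #|_| => [|[|k]].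
(* Two patterns on the same single point match at most once, so [match2] makes them equal. *)
have cW1 : #|W1| <= 1.
  apply/card_le1_eqP => u v; rewrite !inE => /andP[uW /eqP u1] /andP[vW /eqP v1].
  have uv := single _ _ uW vW u1 v1; apply/eqP; rewrite eq_sym; apply: contraT => nuv.
  have := match2 _ _ uW vW uv nuv.
  suff /subset_leq_card : [set x in u.1 | (x \in u.2) == (x \in v.2)] \subset u.1.
    by rewrite u1 leqNgt => /negbTE ->.
  by apply/subsetP => x; rewrite inE => /andP[].
have cW2 : #|W2| <= \sum_(S : {set 'I_p}) (if 1 < #|S| then max_words #|S| 2 else 0).
  rewrite -sum1_card (partition_big fst predT) //=; apply: leq_sum => S _.
  case: ifP => S1; last first.
    by rewrite big1 // => u /andP[+ /eqP uS]; rewrite inE uS S1 andbF.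
  pose G := [set A | (S, A) \in W].
  rewrite (reindex_onto (pair S) snd) /=; last by move=> [? ?] /andP[_ /= /eqP <-].
  rewrite (eq_bigl (mem G)) => [|A]; last by rewrite !inE /= S1 !eqxx !andbT.
  rewrite sum1_card; apply: leq_max_words => [A|A B]; rewrite !inE.
    by move/sub.
  move=> AW BW nAB; apply: (match2 (S, A) (S, B)) => //.
  by apply: contraNneq nAB => -[->].
rewrite (sum_over_card _ (fun k => if 1 < k then max_words k 2 else 0)) card_ord in cW2.
(* The summand 2 leaves one unit for [W1] and one for strictness, later taken by the origin. *)
have -> : Nbar p = (\sum_(k < p.+1) 'C(p, k) * (if 1 < k then max_words k 2 else 0)) + 2.
  case: p p1 {W sub nonempty single match2 W1 W2 W12 cW1 cW2} => [|[|p]] // _.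
  by rewrite Nbar_rev !(big_ord_recl p.+2) (big_ord_recl p.+1) /= !muln0 !add0n.
lia.
Qed.

End SignPatterns.

(* Imported only here because [all_classical] shadows the names of [finset]. *)
From mathcomp Require Import all_order all_algebra.
From mathcomp Require Import all_classical all_reals all_analysis.
From mathcomp Require Import ring lra.

Import Order.TTheory GRing.Theory Num.Theory.
Import numFieldNormedType.Exports.
Local Open Scope classical_set_scope.
Local Open Scope ring_scope.

(** * Hypergeometric sums *)

Section HypergeometricSums.
Local Open Scope ring_scope.
Variable R : realType.
Implicit Types (a b : seq R) (z : R).

(** A hypergeometric series is determined by its first term and the ratio of consecutive terms, here
    cleared of denominators. As [g] vanishes from [n] on, the partial sums are eventually
    constant. *)
Lemma hypergeometric_sum a b z (g : nat -> R) n :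
  g 0%N = 1 -> (forall j, (n <= j)%N -> g j = 0) ->
  (forall j, \prod_(c <- b) (c + j%:R) != 0) ->
  (forall j, g j.+1 * (\prod_(c <- b) (c + j%:R) * j.+1%:R) =
             g j * (\prod_(c <- a) (c + j%:R) * z)) ->
  hypergeometric a b z = \sum_(j < n) g j.
Proof.
move=> g0 gn b0 grec.
have poch0 (c : R) : pochhammer c 0 = 1 by rewrite /pochhammer big_ord0.
have pochS (c : R) j : pochhammer c j.+1 = pochhammer c j * (c + j%:R).
  by rewrite /pochhammer big_ord_recr.
have termE j : hypergeometric_term a b z j = g j.
  elim: j => [|j IH]; rewrite /hypergeometric_term.
    rewrite !big1 => [|c _|c _]; [by rewrite fact0 expr0 g0 divr1 !mul1r | |];
      exact: poch0.
  have nz : \prod_(c <- b) (c + j%:R) * j.+1%:R != 0 by rewrite mulf_neq0 ?b0 ?pnatr_eq0.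
  apply: (mulIf nz); rewrite grec -IH /hypergeometric_term.
  rewrite (eq_bigr (fun c => pochhammer c j * (c + j%:R))) => [|c _]; last exact: pochS.
  rewrite [X in _ / X](eq_bigr (fun c => pochhammer c j * (c + j%:R))) => [|c _];
    last exact: pochS.
  rewrite !big_split /= factS natrM exprS !invfM.
  set P := (\prod_(c <- b) pochhammer c j)^-1; set Q := j`!%:R^-1.
  have v0 : j.+1%:R != 0 :> R by rewrite pnatr_eq0.
  by field; rewrite b0 nat1r v0.
rewrite /hypergeometric; apply: cvg_lim => //.
apply: (@cvg_near_cst _ _ _ _ \oo); exists n => // m /= nm.
rewrite /series /= big_mkord [RHS](big_ord_widen _ _ nm) [RHS]big_mkcond /=.
apply: eq_bigr => i _; rewrite termE; case: ltnP => // ni.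
exact: gn.
Qed.

Lemma natr_mul_bin_left n m :
  m.+1%:R * 'C(n, m.+1)%:R = (n%:R - m%:R) * 'C(n, m)%:R :> R.
Proof.
have [mn|nm] := leqP m n; first by rewrite -natrB // -!natrM mul_bin_left.
by rewrite !bin_small // ?mulr0 // ltnW.
Qed.

Lemma natr_mul_bin_left2 n m :
  m.+1%:R * m.+2%:R * 'C(n, m.+2)%:R = (n%:R - m%:R) * (n%:R - m%:R - 1) * 'C(n, m)%:R :> R.
Proof.
rewrite -mulrA natr_mul_bin_left mulrCA natr_mul_bin_left -[m.+1%:R]natr1; ring.
Qed.

Lemma natr_double n : n.*2%:R = 2 * n%:R :> R.
Proof. by rewrite -mul2n natrM. Qed.

Lemma natr_central_binS j : (j%:R + 1) * 'C(j.+1.*2, j.+1)%:R =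
  2 * (2 * j%:R + 1) * 'C(j.*2, j)%:R :> R.
Proof. by rewrite -natr_double !natr1 -!natrM central_binS. Qed.

(** The sum is the central trinomial coefficient. The hypothesis says that [a1] and [a2] are
    [- p / 2] and [(1 - p) / 2] in some order, which covers both parities. *)
Lemma trinomial_hypergeometric p (a1 a2 : R) :
  (forall x : R, (a1 + x) * (a2 + x) * 4 = (p%:R - 2 * x) * (p%:R - 2 * x - 1)) ->
  hypergeometric [:: a1; a2] [:: 1] 4 =
  \sum_(j < (p./2).+1) ('C(p, j.*2) * 'C(j.*2, j))%:R.
Proof.
move=> a12; apply: (@hypergeometric_sum _ _ _ (fun j => ('C(p, j.*2) * 'C(j.*2, j))%:R)).
- by rewrite !bin0.
- by move=> j jp; rewrite bin_small //; lia.
- by move=> j; rewrite big_seq1 nat1r pnatr_eq0.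
move=> j; rewrite !big_cons !big_nil !mulr1 nat1r a12 !natrM.
have h1 := natr_mul_bin_left2 p j.*2; have h2 := natr_central_binS j.
rewrite -!natr1 natr_double in h1 *.
rewrite [LHS](_ : _ = 'C(p, j.*2.+2)%:R * (j%:R + 1) *
  ((j%:R + 1) * 'C(j.+1.*2, j.+1)%:R)); last by rewrite doubleS; ring.
rewrite h2 [RHS](_ : _ = 'C(j.*2, j)%:R *
  ((p%:R - 2 * j%:R) * (p%:R - 2 * j%:R - 1) * 'C(p, j.*2)%:R));
  last by ring.
rewrite -h1; ring.
Qed.

(** The factor [2 * l + 1] is the summand [j = 0], so the sum divided by it starts with 1. *)
Lemma odd_hypergeometric l :
  (2 * l + 1)%:R * hypergeometric [:: - l%:R; 2^-1 - l%:R; 2^-1] [:: 1; 3 / 2] 4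
  = \sum_(j < l.+1) ('C(l.*2.+1, j.*2.+1) * 'C(j.*2, j))%:R :> R.
Proof.
rewrite mul2n addn1; have l0 : l.*2.+1%:R != 0 :> R by rewrite pnatr_eq0.
apply: (mulfI (invr_neq0 l0)); rewrite mulKf // big_distrr /=.
apply: (@hypergeometric_sum _ _ _
  (fun j => l.*2.+1%:R^-1 * ('C(l.*2.+1, j.*2.+1) * 'C(j.*2, j))%:R)).
- by rewrite bin1 bin0 muln1 mulVf.
- by move=> j lj; rewrite bin_small ?mul0n ?mulr0 //; lia.
- move=> j; rewrite big_cons big_seq1 nat1r.
  by rewrite mulf_neq0 ?pnatr_eq0 // gt_eqF // ltr_wpDr ?ler0n.
move=> j; rewrite !big_cons !big_nil; set K := _^-1.
have h1 := natr_mul_bin_left2 l.*2.+1 j.*2.+1; have h2 := natr_central_binS j.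
rewrite -!natr1 !natr_double in h1; rewrite -[j.+1%:R]natr1 !natrM.
rewrite [LHS](_ : _ = K * ((j%:R + 1) * 'C(j.+1.*2, j.+1)%:R) * 4^-1 *
  ((2 * j%:R + 1 + 1) * (2 * j%:R + 1 + 1 + 1) * 'C(l.*2.+1, j.*2.+3)%:R)).
  by rewrite h1 h2; field.
by rewrite doubleS; field.
Qed.

(* The sum is read backwards: term [j] of the series is summand [l - 1 - j]. *)
Lemma even_hypergeometric l : (0 < l)%N ->
  (2 * l)%:R * 'C(2 * l - 2, l - 1)%:R
         * hypergeometric [:: 1 - l%:R; 1 - l%:R; 2^-1 - l%:R]
                          [:: 3 / 2; 3 / 2 - l%:R] 4^-1
  = \sum_(j < l) ('C(l.*2, j.*2.+1) * 'C(j.*2, j))%:R :> R.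
Proof.
case: l => // l _; rewrite (reindex_inj rev_ord_inj) /=.
pose g j : R := if (j <= l)%N then ('C(l.+1.*2, j.*2.+1) * 'C((l - j).*2, l - j))%:R else 0.
transitivity (\sum_(j < l.+1) g j); last first.
  apply: eq_bigr => j _; have jl : (j <= l)%N by rewrite -ltnS ltn_ord.
  rewrite /g jl subSS -[in LHS]bin_sub; last by lia.
  by congr ('C(_, _) * _)%:R; lia.
have -> : (2 * l.+1 - 2)%N = l.*2 by lia.
rewrite subn1 /= -natrM mul2n; set K := (_ * _)%N.
have K0 : K%:R != 0 :> R by rewrite pnatr_eq0 muln_eq0 /= -lt0n bin_gt0 -addnn leq_addr.
apply: (mulfI (invr_neq0 K0)); rewrite mulKf // big_distrr /=.
apply: (@hypergeometric_sum _ _ _ (fun j => K%:R^-1 * g j)).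
- by rewrite /g /= subn0 bin1 mulVf.
- by move=> j lj; rewrite /g leqNgt lj mulr0.
- move=> j; rewrite big_cons big_seq1 mulf_neq0 //.
  (* Half the difference of an odd and an even number, hence nonzero. *)
  have -> : 3 / 2 - l.+1%:R + j%:R = ((3 + j.*2)%:R - l.+1.*2%:R) / 2 :> R.
    by rewrite natrD !natr_double; field.
  rewrite mulf_neq0 ?invr_eq0 ?pnatr_eq0 // subr_eq0 eqr_nat; apply/eqP; lia.
move=> j; rewrite !big_cons !big_nil /g; set k := K%:R^-1.
(* At [j = l] the upper parameter [1 - l.+1%:R] has climbed to zero and ends the series. *)
have [jl|lj|->] := ltngtP j l; first last.
- rewrite (_ : 1 - l.+1%:R + l%:R = 0) ?ltnn ?(mulr0, mul0r) //.
  by rewrite -natr1; ring.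
- by rewrite !(mulr0, mul0r).
have [n ln] : exists n, l = (j + n.+1)%N by exists (l - j.+1)%N; lia.
have lR : l%:R = j%:R + (n%:R + 1) :> R by rewrite natr1 -natrD ln.
have -> : (l - j = n.+1)%N by rewrite ln addKn.
have -> : (l - j.+1 = n)%N by rewrite ln addnS -addSn addKn.
have h1 := natr_mul_bin_left2 l.+1.*2 j.*2.+1; have h2 := natr_central_binS n.
rewrite natr_double -[l.+1%:R]natr1 lR -[j.*2.+3%:R]natr1 -[j.*2.+2%:R]natr1
  -[j.*2.+1%:R]natr1 natr_double in h1.
rewrite -[l.+1%:R]natr1 lR -[j.+1%:R]natr1 !natrM.
rewrite [RHS](_ : _ = - (k * ((n%:R + 1) * 'C(n.+1.*2, n.+1)%:R) * 16^-1 *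
  ((2 * (j%:R + (n%:R + 1) + 1) - (2 * j%:R + 1)) *
   (2 * (j%:R + (n%:R + 1) + 1) - (2 * j%:R + 1) - 1) *
   'C(l.+1.*2, j.*2.+1)%:R))).
  by rewrite h2 -h1 doubleS; field.
by field.
Qed.

End HypergeometricSums.

(** * The lasso path *)

Section Dot.
Variables (R : realType).

Definition dot n (u v : 'cV[R]_n) : R := (u^T *m v) 0 0.

Lemma dotE n (u v : 'cV[R]_n) : dot u v = \sum_j u j 0 * v j 0.
Proof. by rewrite /dot mxE; apply: eq_bigr => j _; rewrite mxE. Qed.

Lemma dotC n (u v : 'cV[R]_n) : dot u v = dot v u.
Proof. by rewrite !dotE; apply: eq_bigr => j _; rewrite mulrC. Qed.

Lemma dotDl n (u v w : 'cV[R]_n) : dot (u + v) w = dot u w + dot v w.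
Proof. by rewrite /dot linearD mulmxDl mxE. Qed.

Lemma dotZl n a (u w : 'cV[R]_n) : dot (a *: u) w = a * dot u w.
Proof. by rewrite /dot linearZ -scalemxAl mxE. Qed.

Lemma dotNl n (u w : 'cV[R]_n) : dot (- u) w = - dot u w.
Proof. by rewrite -scaleN1r dotZl mulN1r. Qed.

Lemma dotDr n (u v w : 'cV[R]_n) : dot w (u + v) = dot w u + dot w v.
Proof. by rewrite dotC dotDl !(dotC w). Qed.

Lemma dotZr n a (u w : 'cV[R]_n) : dot w (a *: u) = a * dot w u.
Proof. by rewrite dotC dotZl (dotC w). Qed.

Lemma dotNr n (u w : 'cV[R]_n) : dot w (- u) = - dot w u.
Proof. by rewrite dotC dotNl (dotC w). Qed.

Lemma dot_trmx m n (M : 'M[R]_(m, n)) u v : dot (M^T *m u) v = dot u (M *m v).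
Proof. by rewrite /dot trmx_mul trmxK mulmxA. Qed.

Lemma dot_ge0 n (u : 'cV[R]_n) : 0 <= dot u u.
Proof. by rewrite dotE sumr_ge0 // => j _; rewrite -expr2 sqr_ge0. Qed.

Lemma dot_eq0 n (u : 'cV[R]_n) : dot u u = 0 -> u = 0.
Proof.
rewrite dotE => /eqP; rewrite psumr_eq0 => [/allP u0|j _]; last by rewrite -expr2 sqr_ge0.
apply/matrixP => i j; rewrite (ord1 j) mxE.
by have := u0 i (mem_index_enum i); rewrite mulf_eq0 orbb => /eqP.
Qed.

Lemma dot_delta n (u : 'cV[R]_n) j : dot u (delta_mx j 0) = u j 0.
Proof.
rewrite dotE (bigD1 j) //= mxE !eqxx mulr1 big1 ?addr0 // => i ij.
by rewrite mxE (negbTE ij) mulr0.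
Qed.

Lemma dot_cauchy n (u v : 'cV[R]_n) : dot u v ^+ 2 <= dot u u * dot v v.
Proof.
have [v0|v0] := eqVneq (dot v v) 0.
  have -> : v = 0 by apply: dot_eq0.
  by rewrite -(scale0r 0) !dotZr !mul0r expr0n mulr0.
have vp : 0 < dot v v by rewrite lt0r v0 dot_ge0.
have := dot_ge0 (dot v v *: u - dot u v *: v).
rewrite !(dotDl, dotDr, dotNl, dotNr, dotZl, dotZr) (dotC v u) => h.
rewrite -subr_ge0 -(pmulr_rge0 _ vp); lra.
Qed.

Lemma l1norm_ge0 n (b : 'cV[R]_n) : 0 <= l1norm b.
Proof. exact: sumr_ge0. Qed.

Lemma l1normD n (b c : 'cV[R]_n) : l1norm (b + c) <= l1norm b + l1norm c.
Proof. by rewrite -big_split /= ler_sum // => j _; rewrite mxE ler_normD. Qed.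

Lemma l1normZ n a (b : 'cV[R]_n) : l1norm (a *: b) = `|a| * l1norm b.
Proof. by rewrite /l1norm big_distrr /=; apply: eq_bigr => j _; rewrite mxE normrM. Qed.

Lemma l1norm_delta n (j : 'I_n) : l1norm (delta_mx j 0 : 'cV[R]_n) = 1.
Proof.
rewrite /l1norm (bigD1 j) //= mxE !eqxx normr1 big1 ?addr0 // => i ij.
by rewrite mxE (negbTE ij) normr0.
Qed.

Lemma l1norm_eq0 n (b : 'cV[R]_n) : l1norm b = 0 -> b = 0.
Proof.
move/eqP; rewrite psumr_eq0 // => /allP b0.
apply/matrixP => i j; rewrite (ord1 j) mxE.
by have := b0 i (mem_index_enum i); rewrite normr_eq0 => /eqP.
Qed.

Lemma dot_le_l1norm n (u v : 'cV[R]_n) a :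
  (forall j, `|u j 0| <= a) -> dot u v <= a * l1norm v.
Proof.
move=> ua; rewrite dotE big_distrr /= ler_sum // => j _.
by rewrite (le_trans (ler_norm _)) // normrM ler_wpM2r.
Qed.

End Dot.

(** * Optimality conditions for the lasso *)

Section Kkt.
Variables (R : realType) (p N : nat) (X : 'M[R]_(N, p)) (y : 'cV[R]_N).
Implicit Types (b c d : 'cV[R]_p) (t a : R).

(** Minus the gradient of [sq_loss]: the residual correlations, without the factor [1 / N]. *)
Definition neg_grad b : 'cV[R]_p := X^T *m (y - X *m b).

Lemma neg_gradD b d : neg_grad (b + d) = neg_grad b - X^T *m (X *m d).
Proof. by rewrite /neg_grad [X *m (_ + _)]mulmxDr opprD addrA [LHS]mulmxBr. Qed.

Lemma sq_loss_dot b : sq_loss X y b = 2^-1 * dot (y - X *m b) (y - X *m b).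
Proof.
rewrite /sq_loss dotE; congr (_ * _); apply: eq_bigr => i _; rewrite -expr2.
congr (_ ^+ 2); rewrite !mxE; congr (_ - _); apply: eq_bigr => j _.
by rewrite mulrC.
Qed.

Lemma sq_lossD b d : sq_loss X y (b + d) =
  sq_loss X y b - dot (neg_grad b) d + 2^-1 * dot (X *m d) (X *m d).
Proof.
rewrite !sq_loss_dot /neg_grad dot_trmx mulmxDr opprD addrA.
move: (y - X *m b) => u; rewrite !(dotDl, dotDr, dotNl, dotNr) (dotC (X *m d) u); by field.
Qed.

Lemma estimate_variation t b c :
  is_lasso_estimate X y t b -> l1norm c <= t -> dot (neg_grad b) (c - b) <= 0.
Proof.
move=> [bt bmin] ct; rewrite leNgt; apply/negP; set D := dot _ _ => D0.
set Q := dot (X *m (c - b)) (X *m (c - b)).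
have Q0 : 0 <= Q := dot_ge0 _.
have DQ : 0 < D + Q by rewrite ltr_pwDl.
(* A step in [(0, 1]] with [e * Q <= D], so the linear gain [e * D] exceeds the quadratic loss
   [e ^+ 2 * Q / 2]. *)
pose e := D / (D + Q).
have e0 : 0 < e by rewrite divr_gt0.
have e1 : e <= 1 by rewrite ler_pdivrMr // mul1r lerDl.
have : l1norm (b + e *: (c - b)) <= t.
  have -> : b + e *: (c - b) = (1 - e) *: b + e *: c.
    by apply/matrixP => i j; rewrite !mxE; ring.
  apply: le_trans (l1normD _ _) _; rewrite !l1normZ ger0_norm ?subr_ge0 // gtr0_norm //.
  have : (1 - e) * l1norm b <= (1 - e) * t by rewrite ler_wpM2l ?subr_ge0.
  have : e * l1norm c <= e * t by rewrite ler_wpM2l // ltW.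
  lra.
move=> /bmin; rewrite sq_lossD dotZr -scalemxAr dotZl dotZr -/D -/Q.
have eQ : e * Q <= D by rewrite mulrAC ler_pdivrMr // ler_wpM2l ?ltW // ltrDr.
have eeQ : e * (e * Q) <= e * D by rewrite ler_wpM2l // ltW.
have eD : 0 < e * D by rewrite mulr_gt0.
lra.
Qed.

(** [a] is the Lagrange multiplier of the l1 constraint. *)
Definition kkt b a :=
  [/\ 0 <= a, forall j, `|neg_grad b j 0| <= a
    & forall j, b j 0 != 0 -> neg_grad b j 0 = a * Num.sg (b j 0)].

Lemma kkt_dot b a : kkt b a -> dot (neg_grad b) b = a * l1norm b.
Proof.
move=> [_ _ s]; rewrite dotE big_distrr /=; apply: eq_bigr => j _.
have [->|bj] := eqVneq (b j 0) 0; first by rewrite normr0 !mulr0.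
by rewrite s // -mulrA -normrEsg.
Qed.

Lemma kkt_estimate b a : kkt b a -> is_lasso_estimate X y (l1norm b) b.
Proof.
move=> K; have [a0 ga _] := K; split=> // c cb.
rewrite -(subrKC b c) sq_lossD dotDr dotNr (kkt_dot K).
have := dot_ge0 (X *m (c - b)); have := dot_le_l1norm c ga.
have : a * l1norm c <= a * l1norm b by rewrite ler_wpM2l.
lra.
Qed.

Lemma estimate_kkt t b : (0 < p)%N -> 0 <= t -> is_lasso_estimate X y t b ->
  exists2 a, kkt b a & a = 0 \/ l1norm b = t.
Proof.
move=> p0 t0 est; have [bt _] := est.
have [j0 _ jmax] := arg_maxP (fun j => `|neg_grad b j 0|) (isT : predT (Ordinal p0)).
set a := `|neg_grad b j0 0|.
have ga j : `|neg_grad b j 0| <= a by exact: jmax.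
have a_ge0 : 0 <= a by exact: normr_ge0.
(* The test point is the vertex of the l1 ball in the direction of the largest correlation. *)
have at_le : a * t <= dot (neg_grad b) b.
  have := @estimate_variation t b ((t * Num.sg (neg_grad b j0 0)) *: delta_mx j0 0) est.
  rewrite l1normZ l1norm_delta mulr1 normrM ger0_norm // => h.
  have {}h := h _; rewrite dotDr dotNr dotZr dot_delta -mulrA -normrEsg in h.
  rewrite mulrC -subr_le0 h // -[leRHS]mulr1 ler_wpM2l //.
  by rewrite normr_sg; case: eqP.
have le_ab := dot_le_l1norm b ga.
have ab_le : a * l1norm b <= a * t by rewrite ler_wpM2l.
exists a; first split=> // j bj.
  (* [at_le], [le_ab] and [ab_le] close into equalities, so these nonnegative terms sum to zero and
     each vanishes. *)
  have /eqP : \sum_j (a * `|b j 0| - neg_grad b j 0 * b j 0) = 0.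
    rewrite sumrB -big_distrr /= -dotE -/(l1norm b); lra.
  rewrite psumr_eq0 => [/allP/(_ j (mem_index_enum j))|i _]; last first.
    by rewrite subr_ge0 (le_trans (ler_norm _)) // normrM ler_wpM2r.
  by rewrite subr_eq0 normrEsg mulrA => /eqP/(mulIf bj).
have [->|a0] := eqVneq a 0; [by left | right].
by apply: (mulfI a0); lra.
Qed.

End Kkt.

(** * Consequences of full rank and normalization *)

Section Data.
Variables (R : realType) (p N : nat) (X : 'M[R]_(N, p)) (y : 'cV[R]_N).
Implicit Types (b c d : 'cV[R]_p) (s t a : R).
Hypothesis full : full_rank_data X y.
Hypothesis nrm : normalized X.
Hypothesis p_gt0 : (0 < p)%N.
Local Notation neg_grad := (neg_grad X y).
Local Notation kkt := (kkt X y).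
Local Notation is_lasso_estimate := (is_lasso_estimate X y).

(** If [X *m d = 0], all data points lie in the kernel of the linear form given by [d] and 0; full
    rank makes this kernel everything. *)
Lemma full_rank_injective d : X *m d = 0 -> d = 0.
Proof.
move=> Xd; pose B : 'cV[R]_(p + 1) := col_mx d 0.
pose f : 'Hom('rV[R]_(p + 1), 'rV[R]_1) := linfun (mulmxr B).
have /(full (v := 0)) : forall i, data_point X y i - 0 \in lker f.
  move=> i; rewrite subr0 memv_ker lfunE /= /data_point -row_mul mul_row_col Xd.
  by rewrite mulmx0 addr0 row0.
move=> kerB; apply/matrixP => i j; rewrite (ord1 j) mxE.
have : delta_mx 0 (lshift 1 i) \in lker f by rewrite kerB memvf.
rewrite memv_ker lfunE /= -rowE => /eqP/matrixP/(_ 0 0).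
by rewrite mxE col_mxEu [RHS]mxE.
Qed.

Lemma dot_mulmx_gt0 d : d != 0 -> 0 < dot (X *m d) (X *m d).
Proof.
move=> d0; rewrite lt0r dot_ge0 andbT; apply: contraNneq d0 => /dot_eq0 Xd.
exact/eqP/full_rank_injective.
Qed.

(** As [0^-1 = 0], the covariance of an empty sample would vanish, against normalization. *)
Lemma sample_size_neq0 : N%:R != 0 :> R.
Proof.
apply/eqP => N0; have := nrm (Ordinal p_gt0).
by rewrite /Defs.covariance N0 invr0 scale0r mxE => /eqP; rewrite eq_sym oner_eq0.
Qed.

Lemma dot_column j : dot (X *m delta_mx j 0) (X *m delta_mx j 0) = N%:R.
Proof.
have := nrm j; rewrite /Defs.covariance mxE => h.
rewrite -dot_trmx dot_delta mulmxA -colE mxE -[LHS]mul1r -[in LHS](mulfV sample_size_neq0).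
by rewrite -mulrA h mulr1.
Qed.

(** The normal equations; the covariance is invertible because [X] is injective. *)
Lemma neg_grad_beta_hat : neg_grad (beta_hat X y) = 0.
Proof.
have Ku : Defs.covariance X \in unitmx.
  rewrite unitmxE unitfE; apply/det0P => -[v v0 vK].
  suff /full_rank_injective/(congr1 trmx) : X *m v^T = 0.
    by rewrite trmxK trmx0; exact/eqP.
  apply: dot_eq0; rewrite -dot_trmx dotC /dot trmxK.
  move: vK; rewrite /Defs.covariance -scalemxAr => /eqP; rewrite scaler_eq0 invr_eq0.
  by rewrite (negbTE sample_size_neq0) /= => /eqP; rewrite !mulmxA => ->; rewrite mul0mx mxE.
have : Defs.covariance X *m beta_hat X y = xy_covariance X y by rewrite mulKVmx.
rewrite /Defs.covariance /xy_covariance -scalemxAl => /scalerI h.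
rewrite /neg_grad mulmxBr mulmxA h ?subrr // invr_eq0; exact: sample_size_neq0.
Qed.

Lemma neg_grad_eq0 b : neg_grad b = 0 -> b = beta_hat X y.
Proof.
move=> g0; have := neg_gradD X y b (beta_hat X y - b).
rewrite subrKC neg_grad_beta_hat g0 sub0r => /esym/eqP; rewrite oppr_eq0 => /eqP h.
have /dot_eq0/full_rank_injective/eqP :
    dot (X *m (beta_hat X y - b)) (X *m (beta_hat X y - b)) = 0.
  by rewrite -dot_trmx h -(scale0r (0 : 'cV[R]_p)) dotZl mul0r.
by rewrite subr_eq0 => /eqP.
Qed.

(** First-order optimality at [b] and the positive quadratic term would make [c] strictly worse. *)
Lemma estimate_unique t b c : is_lasso_estimate t b -> is_lasso_estimate t c -> b = c.
Proof.
move=> eb ec; apply/esym/eqP; rewrite -subr_eq0; apply: contraT => /dot_mulmx_gt0.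
have := sq_lossD X y b (c - b); rewrite subrKC.
have := estimate_variation eb ec.1; have := ec.2 b eb.1; lra.
Qed.

Lemma kkt0 b : kkt b 0 -> b = beta_hat X y.
Proof.
move=> [_ g0 _]; apply: neg_grad_eq0; apply/matrixP => i j; rewrite (ord1 j) [RHS]mxE.
by apply/eqP; rewrite -normr_le0.
Qed.

(** The constraint is active unless the multiplier is zero; then [b] is [beta_hat], whose norm
    [t_hat] is at least [t]. *)
Lemma estimate_l1norm t b : 0 <= t <= t_hat X y -> is_lasso_estimate t b -> l1norm b = t.
Proof.
move=> /andP[t0 th] eb; have [a K [a0|//]] := estimate_kkt p_gt0 t0 eb.
move: K; rewrite a0 => /kkt0 bh; apply/le_anti.
by rewrite eb.1 bh.
Qed.

Lemma estimate_kkt_gt0 t b : 0 <= t < t_hat X y -> is_lasso_estimate t b ->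
  exists2 a, kkt b a & 0 < a.
Proof.
move=> /andP[t0 th] eb; have [a K _] := estimate_kkt p_gt0 t0 eb.
exists a => //; have [a0 _ _] := K; rewrite lt0r a0 andbT.
apply: contraTneq th => a00; move: K; rewrite a00 => /kkt0 bh.
by rewrite -leNgt /t_hat -bh eb.1.
Qed.

(** With common signs no cancellation occurs, so signs persist on the segment, the l1 norm is affine
    there, and so is [neg_grad]. *)
Lemma kkt_convex b c a a' e : 0 <= e <= 1 -> sign_vector b = sign_vector c ->
  kkt b a -> kkt c a' ->
  [/\ kkt ((1 - e) *: b + e *: c) ((1 - e) * a + e * a'),
      sign_vector ((1 - e) *: b + e *: c) = sign_vector b
    & l1norm ((1 - e) *: b + e *: c) = (1 - e) * l1norm b + e * l1norm c].
Proof.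
move=> /andP[e0 e1] bc [a0 gb sb] [a'0 gc sc].
have e1' : 0 <= 1 - e by rewrite subr_ge0.
have bcj j : Num.sg (b j 0) = Num.sg (c j 0) by have /matrixP/(_ j 0) := bc; rewrite !mxE.
have sgE j : Num.sg ((1 - e) * b j 0 + e * c j 0) = Num.sg (b j 0).
  have [b0|b0] := eqVneq (b j 0) 0.
    have c0 : c j 0 = 0 by apply/eqP; rewrite -sgr_eq0 -bcj b0 sgr0.
    by rewrite b0 c0 !mulr0 addr0.
  have c0 : c j 0 != 0 by rewrite -sgr_eq0 -bcj sgr_eq0.
  have -> : (1 - e) * b j 0 + e * c j 0 = ((1 - e) * `|b j 0| + e * `|c j 0|) * Num.sg (b j 0).
    by rewrite {1}[b j 0]numEsg {1}[c j 0]numEsg -bcj; ring.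
  rewrite sgrM sgr_id gtr0_sg ?mul1r //.
  have [->|ne0] := eqVneq e 0; first by rewrite subr0 mul0r mul1r addr0 normr_gt0.
  by rewrite ltr_wpDl ?mulr_ge0 // mulr_gt0 ?normr_gt0 // lt0r ne0.
have cE j : ((1 - e) *: b + e *: c) j 0 = (1 - e) * b j 0 + e * c j 0 by rewrite !mxE.
have gE j : neg_grad ((1 - e) *: b + e *: c) j 0 =
    (1 - e) * neg_grad b j 0 + e * neg_grad c j 0.
  have -> : neg_grad ((1 - e) *: b + e *: c) = (1 - e) *: neg_grad b + e *: neg_grad c.
    rewrite /neg_grad !scalemxAr -mulmxDr; congr (_ *m _).
    rewrite mulmxDr -!scalemxAr; move: (X *m b) (X *m c) => u v.
    by apply/matrixP => i k; rewrite !mxE; ring.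
  by move: (neg_grad b) (neg_grad c) => u v; rewrite !mxE.
split.
- split=> [|j|j].
  + by rewrite addr_ge0 ?mulr_ge0.
  + rewrite gE (le_trans (ler_normD _ _)) // !normrM.
    by rewrite (ger0_norm e0) (ger0_norm e1') lerD // ler_wpM2l.
  + rewrite gE cE sgE.
    have [b0|b0 _] := eqVneq (b j 0) 0.
      have c0 : c j 0 = 0 by apply/eqP; rewrite -sgr_eq0 -bcj b0 sgr0.
      by rewrite b0 c0 !mulr0 addr0 eqxx.
    have c0 : c j 0 != 0 by rewrite -sgr_eq0 -bcj sgr_eq0.
    by rewrite sb // sc // -bcj; ring.
- by apply/matrixP => i j; rewrite (ord1 j) !mxE sgE.
- rewrite /l1norm !big_distrr -big_split; apply: eq_bigr => j _; rewrite !mxE.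
  rewrite normrEsg sgE [`|b j 0|]normrEsg [`|c j 0|]normrEsg -bcj /=; ring.
Qed.

(** Injectivity makes the squared norms of the sum and the difference of the two columns
    positive. *)
Lemma dot_columns_lt i j : i != j ->
  `|dot (X *m delta_mx i 0) (X *m delta_mx j 0)| < N%:R.
Proof.
move=> ij; rewrite ltr_norml.
have nz e : delta_mx i 0 + e *: delta_mx j 0 != 0 :> 'cV[R]_p.
  apply/eqP => /matrixP/(_ i 0); rewrite !mxE !eqxx (negbTE ij) mulr0 addr0.
  exact/eqP/oner_neq0.
have q e := dot_mulmx_gt0 (nz e).
have qE e :
    dot (X *m (delta_mx i 0 + e *: delta_mx j 0)) (X *m (delta_mx i 0 + e *: delta_mx j 0))
    = N%:R + 2 * e * dot (X *m delta_mx i 0) (X *m delta_mx j 0) + e ^+ 2 * N%:R.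
  rewrite mulmxDr -scalemxAr !(dotDl, dotDr, dotZl, dotZr) !dot_column.
  rewrite (dotC (X *m delta_mx j 0)); ring.
have := q 1; have := q (- 1); rewrite !qE sqrrN expr1n; lra.
Qed.

Lemma dot_columns_le i j : `|dot (X *m delta_mx i 0) (X *m delta_mx j 0)| <= N%:R.
Proof.
have [->|/dot_columns_lt/ltW //] := eqVneq i j.
by rewrite dot_column normr_nat.
Qed.

Lemma dot_column_le i d : `|dot (X *m delta_mx i 0) (X *m d)| <= N%:R * l1norm d.
Proof.
have dE : d = \sum_j d j 0 *: delta_mx j 0.
  apply/matrixP => k l; rewrite (ord1 l) summxE (bigD1 k) //= !mxE !eqxx mulr1.
  by rewrite big1 ?addr0 // => m mk; rewrite !mxE eq_sym (negbTE mk) mulr0.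
rewrite -dot_trmx dotE (le_trans (ler_norm_sum _ _ _)) // big_distrr /= ler_sum // => j _.
rewrite normrM ler_wpM2r // -dot_delta dot_trmx; exact: dot_columns_le.
Qed.

(* Two sign vectors with the same support that agree only at [i]: pairing
   [neg_grad c - neg_grad b = X^T X (b - c)] with the part [u] of [b - c] off
   [i] and with the [i]-th column contradicts Cauchy-Schwarz, because that
   column has norm [N] by normalization. *)
Lemma two_matches b c a a' : kkt b a -> kkt c a' -> 0 < a -> 0 < a' ->
  (forall j, (b j 0 == 0) = (c j 0 == 0)) -> sign_vector b != sign_vector c ->
  (2 <= #|[set j | ((b j 0 != 0) && (Num.sg (b j 0) == Num.sg (c j 0)))%R]%SET|)%N.
Proof.
move=> [_ _ sb] [_ _ sc] a0 a'0 supp bc; rewrite leqNgt; apply/negP => few.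
pose diff := [set j | Num.sg (b j 0) != Num.sg (c j 0)]%SET.
have oppE j : j \in diff -> 0 < b j 0 /\ c j 0 < 0 \/ b j 0 < 0 /\ 0 < c j 0.
  rewrite inE; have := supp j.
  have [b0|b0|->] := ltgtP (b j 0) 0; have [c0|c0|->] := ltgtP (c j 0) 0;
    rewrite ?eqxx ?(gtr0_sg b0) ?(gtr0_sg c0) ?(ltr0_sg b0) ?(ltr0_sg c0) ?eqxx //=;
    by [left | right | rewrite ?lt_eqF ?gt_eqF].
pose u : 'cV[R]_p := \col_j if j \in diff then b j 0 - c j 0 else 0.
have uE j : u j 0 = if j \in diff then b j 0 - c j 0 else 0 by rewrite mxE.
(* On [diff] the gradient difference is [- (a + a')] times the sign of [u]. *)
have u_grad : dot u (neg_grad c - neg_grad b) = - ((a + a') * l1norm u).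
  rewrite dotE /l1norm big_distrr -sumrN; apply: eq_bigr => j _ /=.
  have -> : (neg_grad c - neg_grad b) j 0 = neg_grad c j 0 - neg_grad b j 0.
    by move: (neg_grad b) (neg_grad c) => v w; rewrite !mxE.
  rewrite uE; case: ifP => [/oppE[[b0 c0]|[b0 c0]]|_]; last by rewrite normr0 mul0r mulr0 oppr0.
    rewrite sb ?gt_eqF // sc ?lt_eqF // (gtr0_sg b0) (ltr0_sg c0)
      gtr0_norm ?subr_gt0 ?(lt_trans c0) //; ring.
  rewrite sb ?lt_eqF // sc ?gt_eqF // (ltr0_sg b0) (gtr0_sg c0)
    ltr0_norm ?subr_lt0 ?(lt_trans b0) //; ring.
have u_gt0 : 0 < l1norm u.
  rewrite lt0r l1norm_ge0 andbT; apply: contra bc => /eqP/l1norm_eq0 u0.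
  apply/eqP/matrixP => j k; rewrite (ord1 k) !mxE; apply/eqP; apply: contraT => jd.
  have {}jd : j \in diff by rewrite inE.
  have := uE j; rewrite jd u0 mxE; case: (oppE j jd) => -[]; lra.
have Xd : neg_grad c - neg_grad b = X^T *m (X *m (b - c)).
  have := neg_gradD X y b (c - b); rewrite subrKC => ->.
  by rewrite addrAC subrr add0r -!mulmxN opprB.
set M := [set j | _]%SET in few.
have Mdiff j : j \notin M -> j \notin diff -> b j 0 - c j 0 = 0.
  rewrite !inE negbK => jM /eqP jd; move: jM; rewrite jd eqxx andbT negbK => /eqP b0.
  by have := supp j; rewrite b0 eqxx => /esym/eqP ->; rewrite subrr.
(* Without any match [u] is [b - c], and [u_grad] makes the squared norm of [X *m u] negative. *)
have [i iM|M0] := pickP (mem M); last first.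
  have ubc : u = b - c.
    apply/matrixP => j k; rewrite (ord1 k) uE !mxE; case: ifPn => // jd.
    by rewrite Mdiff //; apply/negbT/M0.
  move: u_grad; rewrite Xd -ubc dotC dot_trmx.
  have := dot_ge0 (X *m u); have : 0 < (a + a') * l1norm u by rewrite mulr_gt0 ?addr_gt0.
  lra.
have Mi j : j \in M -> j = i.
  by move=> jM; move: few; rewrite ltnS => /card_le1_eqP; apply.
have /andP[bi /eqP sgi] : (b i 0 != 0) && (Num.sg (b i 0) == Num.sg (c i 0)).
  by move: iM; rewrite /= inE.
pose e := b i 0 - c i 0.
have bcE : b - c = u + e *: delta_mx i 0.
  apply/matrixP => j k; rewrite (ord1 k) [RHS]mxE uE !mxE eqxx andbT.
  have [->|ji] := eqVneq j i.
    by rewrite inE sgi eqxx mulr1 add0r.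
  rewrite mulr0 addr0; case: ifPn => // jd; rewrite Mdiff //.
  by apply: contra ji => /Mi ->.
set s := Num.sg (b i 0).
have s2 : s * s = 1 by rewrite -expr2 sqr_sg bi.
pose z := dot (X *m delta_mx i 0) (X *m u).
have zE : z + e * N%:R = (a' - a) * s.
  have -> : (a' - a) * s = (neg_grad c - neg_grad b) i 0.
    have -> : (neg_grad c - neg_grad b) i 0 = neg_grad c i 0 - neg_grad b i 0.
      by move: (neg_grad b) (neg_grad c) => v w; rewrite !mxE.
    by rewrite sb // sc -?supp // -sgi mulrBl.
  rewrite Xd -dot_delta dot_trmx bcE mulmxDr -scalemxAr dotDl dotZl dot_column.
  by rewrite dotC.
have uu : dot (X *m u) (X *m u) + e * z = - ((a + a') * l1norm u).
  by rewrite -u_grad Xd dotC dot_trmx bcE mulmxDr -scalemxAr dotDl dotZl.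
have cs := dot_cauchy (X *m delta_mx i 0) (X *m u); rewrite -/z dot_column in cs.
have z_le := dot_column_le i u; rewrite -/z in z_le.
have N0 : 0 < N%:R :> R by rewrite lt0r sample_size_neq0 ler0n.
have mu : `|a' - a| < a + a' by rewrite ltr_norml; lra.
(* Multiplying [uu] by [N], Cauchy-Schwarz and [zE] bound its left side below by [z * (a' - a) * s],
   which exceeds [- (a + a') * N * l1norm u]. *)
have : - ((a' - a) * s * z) <= `|a' - a| * (N%:R * l1norm u).
  rewrite (le_trans (ler_norm _)) // normrN !normrM (_ : `|s| = 1) ?mulr1 ?ler_wpM2l //.
  by rewrite normr_sg bi.
have : `|a' - a| * (N%:R * l1norm u) < (a + a') * (N%:R * l1norm u).
  by rewrite ltr_pM2r // mulr_gt0.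
have : N%:R * (dot (X *m u) (X *m u) + e * z) = - (N%:R * ((a + a') * l1norm u)).
  by rewrite uu mulrN.
rewrite -zE; nra.
Qed.

(** Going from [b] back to 0 adds to each correlation [b i 0] times an inner product with column
    [i]. For [i] this gives exactly [a] plus [N] times the modulus of [b i 0]; for [j] it stays
    strictly below. *)
Lemma single_predictor b a i j : kkt b a -> b i 0 != 0 ->
  (forall k, k != i -> b k 0 = 0) -> j != i -> `|neg_grad 0 j 0| < `|neg_grad 0 i 0|.
Proof.
move=> [a0 gb sb] bi b0 ji.
have bE : b = b i 0 *: delta_mx i 0.
  apply/matrixP => k l; rewrite (ord1 l) !mxE eqxx andbT.
  by have [->|/b0 ->] := eqVneq k i; rewrite ?mulr1 ?mulr0.
have Xb : X *m b = b i 0 *: (X *m delta_mx i 0) by rewrite {1}bE -scalemxAr.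
have g0 k : neg_grad 0 k 0 =
    neg_grad b k 0 + b i 0 * dot (X *m delta_mx k 0) (X *m delta_mx i 0).
  have := neg_gradD X y 0 b; rewrite add0r => /matrixP/(_ k 0).
  have subE (v w : 'cV[R]_p) : (v - w) k 0 = v k 0 - w k 0 by rewrite !mxE.
  rewrite subE -[(X^T *m (X *m b)) k 0]dot_delta dot_trmx Xb dotZl (dotC (X *m delta_mx i 0)).
  by move=> ->; rewrite subrK.
have bi0 : 0 < `|b i 0| by rewrite normr_gt0.
have -> : `|neg_grad 0 i 0| = a + `|b i 0| * N%:R.
  rewrite g0 sb // dot_column {2}[b i 0]numEsg mulrC -mulrA -mulrDr normrM normr_sg bi mul1r.
  by rewrite ger0_norm // addr_ge0 // mulr_ge0 ?ler0n.
rewrite g0 (le_lt_trans (ler_normD _ _)) // normrM ler_ltD //.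
by rewrite ltr_pM2l // dot_columns_lt.
Qed.

End Data.

(** * Counting the segments of the path *)

Section Segments.
Variables (R : realType) (p N : nat) (X : 'M[R]_(N, p)) (y : 'cV[R]_N).
Variable beta : R -> 'cV[R]_p.
Hypothesis full : full_rank_data X y.
Hypothesis nrm : normalized X.
Hypothesis p_gt1 : (1 < p)%N.
Hypothesis path : is_lasso_path X y beta.
Let p_gt0 : (0 < p)%N := ltnW p_gt1.

(** Support and positive part encode the sign vector in a finite type, as [card_sign_patterns]
    expects. *)
Definition sign_pattern (b : 'cV[R]_p) : {set 'I_p} * {set 'I_p} :=
  ([set j | b j 0 != 0]%SET, [set j | 0 < b j 0]%SET).

Lemma sign_patternP (b c : 'cV[R]_p) :
  sign_pattern b = sign_pattern c <-> sign_vector b = sign_vector c.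
Proof.
split=> [[/setP S /setP A]|E].
  apply/matrixP => j k; rewrite (ord1 k) !mxE; have := S j; have := A j; rewrite !inE.
  have [b0|b0|->] := ltgtP (b j 0) 0; have [c0|c0|->] := ltgtP (c j 0) 0;
    by rewrite ?eqxx ?(gtr0_sg b0) ?(gtr0_sg c0) ?(ltr0_sg b0) ?(ltr0_sg c0) ?sgr0.
have sgE j : Num.sg (b j 0) = Num.sg (c j 0) by have /matrixP/(_ j 0) := E; rewrite !mxE.
congr (_, _); apply/setP => j; rewrite !inE.
  by rewrite -sgr_eq0 sgE sgr_eq0.
by rewrite -sgr_gt0 sgE sgr_gt0.
Qed.

Lemma sign_pattern_eq0 (b : 'cV[R]_p) : sign_pattern b = sign_pattern 0 -> b = 0.
Proof.
move=> [/setP b0 _]; apply/matrixP => j k; rewrite (ord1 k) mxE.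
by have := b0 j; rewrite !inE mxE eqxx => /negbFE/eqP.
Qed.

Lemma l1norm0 : l1norm (0 : 'cV[R]_p) = 0.
Proof. by rewrite /l1norm big1 // => j _; rewrite mxE normr0. Qed.

Lemma beta_l1norm t : 0 <= t <= t_hat X y -> l1norm (beta t) = t.
Proof.
move=> t0; apply: (estimate_l1norm full nrm p_gt0 t0); apply: path.
by case/andP: t0.
Qed.

Lemma beta0 : beta 0 = 0.
Proof.
by apply: l1norm_eq0; apply/le_anti; rewrite l1norm_ge0 (path (lexx 0)).1.
Qed.

(** The convex combination of [beta s] and [beta t] with norm [r] is again a KKT point, hence equals
    [beta r] by uniqueness. *)
Lemma sign_between s t r : 0 <= s -> s <= r <= t -> t <= t_hat X y ->
  sign_vector (beta s) = sign_vector (beta t) ->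
  sign_vector (beta r) = sign_vector (beta s).
Proof.
move=> s0 /andP[sr rt] th st.
have t0 : 0 <= t by rewrite (le_trans s0) // (le_trans sr).
have [eqst|nst] := eqVneq s t.
  by have -> : r = s by apply/le_anti; rewrite sr eqst rt.
have {}nst : 0 < t - s by rewrite subr_gt0 lt_neqAle nst (le_trans sr).
pose e := (r - s) / (t - s).
have e01 : 0 <= e <= 1.
  apply/andP; split; first by apply: divr_ge0; [rewrite subr_ge0 | exact: ltW].
  by rewrite ler_pdivrMr // mul1r lerD2r.
have rE : (1 - e) * s + e * t = r.
  have -> : (1 - e) * s + e * t = s + e * (t - s) by ring.
  by rewrite /e divfK ?gt_eqF // subrKC.
have ss : 0 <= s <= t_hat X y by rewrite s0 (le_trans sr) // (le_trans rt).
have tt : 0 <= t <= t_hat X y by rewrite t0.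
have [a Ka _] := estimate_kkt p_gt0 s0 (path s0).
have [a' Ka' _] := estimate_kkt p_gt0 t0 (path t0).
have [K sgE nE] := kkt_convex e01 st Ka Ka'.
rewrite -sgE; congr sign_vector; apply: (estimate_unique full (t := r)).
  by apply: path; rewrite (le_trans s0).
have := kkt_estimate K; by rewrite nE (beta_l1norm ss) (beta_l1norm tt) rE.
Qed.

(** The interval is open because the origin is counted apart and the multiplier is surely positive
    only before [t_hat]. *)
Definition attained : {set {set 'I_p} * {set 'I_p}} :=
  [set u | `[< exists2 t, 0 < t < t_hat X y & sign_pattern (beta t) = u >]]%SET.

Lemma card_attained : (#|attained| < Nbar p)%N.
Proof.
have attP u : u \in attained -> exists b a,
    [/\ kkt X y b a, 0 < a, 0 < l1norm b & sign_pattern b = u].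
  rewrite inE => /asboolP[t /andP[t0 th] <-].
  have tt : 0 <= t <= t_hat X y by rewrite !ltW.
  have [|a K a0] := estimate_kkt_gt0 full nrm p_gt0 _ (path (ltW t0)); first by rewrite ltW.
  by exists (beta t), a; split=> //; rewrite beta_l1norm.
apply: card_sign_patterns => // [u|u|u v|u v].
- move=> /attP[b [a [_ _ _ <-]]]; apply/fintype.subsetP => j; rewrite !inE.
  exact: lt0r_neq0.
- move=> /attP[b [a [_ _ + <-]]]; apply: contraTneq => /setP b0.
  suff -> : b = 0 by rewrite l1norm0 ltxx.
  apply/matrixP => j k; rewrite (ord1 k) mxE; have := b0 j; rewrite !inE.
  by move/negbFE/eqP.
- move=> /attP[b [a [Kb _ _ <-]]] /attP[c [a' [Kc _ _ <-]]] /=.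
  move=> /eqP/cards1P[i bi] /eqP/cards1P[j cj].
  rewrite bi cj; congr [set _]%SET; apply/eqP; apply: contraT => ij.
  have off (d : 'cV[R]_p) k l :
      [set j | d j 0 != 0 :> R]%SET = [set k]%SET -> l != k -> d l 0 = 0 :> R.
    by move=> /setP/(_ l); rewrite !inE => + /negbTE lk; rewrite lk => /negbFE/eqP.
  have on (d : 'cV[R]_p) k : [set j | d j 0 != 0 :> R]%SET = [set k]%SET -> d k 0 != 0 :> R.
    by move=> /setP/(_ k); rewrite !inE eqxx.
  (* Each of two distinct single predictors would correlate more strongly with the response than the
     other. *)
  have h := @single_predictor _ _ _ _ _ full nrm p_gt0 _ _ i j Kb
    (on _ _ bi) (fun k => off _ _ k bi).
  have h' := @single_predictor _ _ _ _ _ full nrm p_gt0 _ _ j i Kc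
    (on _ _ cj) (fun k => off _ _ k cj).
  have := lt_trans (h _) (h' ij); rewrite ltxx eq_sym; exact.
move=> /attP[b [a [Kb a0 _ <-]]] /attP[c [a' [Kc a'0 _ <-]]] /= /setP supp nbc.
have {}supp j : (b j 0 == 0) = (c j 0 == 0).
  by have := supp j; rewrite !inE => /negb_inj.
have {}nbc : sign_vector b != sign_vector c.
  by apply: contraNneq nbc => /sign_patternP ->.
apply: leq_trans (two_matches full nrm p_gt0 Kb Kc a0 a'0 supp nbc) _.
apply/subset_leq_card/fintype.subsetP => j; rewrite !inE => /andP[-> /eqP sg] /=.
by rewrite -(sgr_gt0 (b j 0)) sg sgr_gt0 eqxx.
Qed.

Lemma card_lasso_segments : (lasso_segments X y beta #<= `I_(Nbar p))%card.
Proof.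
pose W := (sign_pattern 0 |: attained)%SET.
(* The sign pattern at some chosen point of [I]; the default 0 only matters for empty [I]. *)
pose f (I : set R) := sign_pattern (beta (xget 0 I)).
have segP I : is_segment X y beta I -> I (xget 0 I) /\ f I \in attained.
  move=> [[_ It Isg] _ [s [t [Is It' st]]]].
  have Ix : I (xget 0 I) by apply: xgetPex; exists s.
  (* The smaller parameter [s] lies below [t_hat], and it is positive since the signs at [t] are not
     those of the origin. *)
  split=> //; rewrite inE; apply/asboolP; exists s; last first.
    exact/sign_patternP/Isg.
  have /andP[s0 sh] := It s Is; have /andP[t0 th] := It t It'.
  rewrite (lt_le_trans st th) andbT lt0r s0 andbT; apply: contraTneq st => s00.
  have := Isg s t Is It'; rewrite s00.
  rewrite beta0.
  move=> /esym/sign_patternP/sign_pattern_eq0 b0.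
  by rewrite -leNgt -(@beta_l1norm t) ?t0 // b0 l1norm0.
have f0 : f [set 0] = sign_pattern 0.
  have x0 : [set 0] (xget 0 [set 0] : R) by apply: xgetPex; exists 0.
  by rewrite /f x0 beta0.
have n0 : sign_pattern 0 \notin attained.
  rewrite inE; apply/asboolP => -[t /andP[t0 th] /sign_pattern_eq0 b0].
  by have := @beta_l1norm t; rewrite b0 l1norm0 !ltW // => /(_ isT) t00; rewrite -t00 ltxx in t0.
(* All parameters with the pattern of [I] form an interval, so maximality makes it [I] itself and
   the pattern determines the segment. *)
have seg_max I : is_segment X y beta I ->
    [set r | 0 <= r <= t_hat X y /\ sign_pattern (beta r) = f I] = I.
  move=> segI; have [Ix _] := segP I segI; case: segI => -[_ It Isg] Imax _.
  apply: Imax => [|r Ir]; last first.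
    by split; [exact: It | apply/sign_patternP; exact: Isg].
  split=> [r s [/andP[r0 rh] rf] [/andP[s0 sh] sf] q /andP[rq qs]|r [] //|r s [_ rf] [_ sf]].
    split; first by rewrite (le_trans r0) //= (le_trans qs).
    rewrite -rf; apply/sign_patternP; apply: (@sign_between r s q) => //; first by rewrite rq.
    by apply/sign_patternP; rewrite rf sf.
  by apply/sign_patternP; rewrite rf sf.
have f_inj : {in lasso_segments X y beta &, injective f}.
  move=> I J /set_mem[sI|->] /set_mem[sJ|->] // fIJ.
  - by rewrite -(seg_max I sI) -(seg_max J sJ) fIJ.
  - by have [_] := segP I sI; rewrite fIJ f0 (negbTE n0).
  - by have [_] := segP J sJ; rewrite -fIJ f0 (negbTE n0).
have fW I : lasso_segments X y beta I -> f I \in enum W.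
  by rewrite mem_enum => -[/segP[_ fI]|->]; rewrite in_setU1 ?fI ?orbT // f0 eqxx.
have g_inj : {in lasso_segments X y beta &, injective (fun I => index (f I) (enum W))}.
  move=> I J sI sJ /(congr1 (nth (sign_pattern 0) (enum W))).
  by rewrite !nth_index ?fW //; [exact: f_inj | exact: set_mem | exact: set_mem].
(* Positions in the list of patterns embed the segments into the naturals below [#|W|]. *)
rewrite -(card_le_eql (inj_card_eq g_inj)); apply: subset_card_le => _ [I sI <-] /=.
apply: (@leq_trans #|W|); first by rewrite cardE index_mem fW.
by rewrite cardsU1 n0 add1n card_attained.
Qed.

End Segments.

Theorem theorem7p1 (R : realType) :
  (forall (p N : nat) (X : 'M[R]_(N, p)) (y : 'cV[R]_N) (beta : R -> 'cV[R]_p),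
     (2 <= p)%N ->
     centered X y -> full_rank_data X y -> normalized X ->
     is_lasso_path X y beta ->
     (lasso_segments X y beta #<= `I_(Nbar p))%card)
  /\
  (forall l : nat, (1 <= l)%N ->
     (Nbar (2 * l))%:R =
       (3 ^+ (2 * l) + 4
        - hypergeometric [:: - l%:R; 2^-1 - l%:R] [:: 1] 4) / 2
       - (2 * l)%:R * 'C(2 * l - 2, l - 1)%:R
         * hypergeometric [:: 1 - l%:R; 1 - l%:R; 2^-1 - l%:R]
                          [:: 3 / 2; 3 / 2 - l%:R] 4^-1
       :> R)
  /\
  (forall l : nat, (1 <= l)%N ->
     (Nbar (2 * l + 1))%:R =
       (3 ^+ (2 * l + 1) + 4
        - hypergeometric [:: - l%:R; - l%:R - 2^-1] [:: 1] 4) / 2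
       - (2 * l + 1)%:R
         * hypergeometric [:: - l%:R; 2^-1 - l%:R; 2^-1] [:: 1; 3 / 2] 4
       :> R).
Proof.
(* Carries the subtraction-free identities over the naturals to the real form of the statement. *)
have solve n e o s : (2 * n + e + 2 * o = s + 4)%N ->
    n%:R = (s%:R + 4 - e%:R) / 2 - o%:R :> R.
  move=> /(congr1 (fun k => k%:R : R)).
  rewrite natrD (natrD _ (2 * n)) (natrD _ s) !natrM; lra.
split=> [p N X y beta p2 _ full nrm path|]; first exact: card_lasso_segments.
split=> l l1.
  rewrite even_hypergeometric // (@trinomial_hypergeometric _ l.*2) => [|x]; last first.
    by rewrite natr_double; field.
  by rewrite mul2n doubleK -!natr_sum -natrX; exact/solve/Nbar_even.
rewrite odd_hypergeometric (@trinomial_hypergeometric _ l.*2.+1) => [|x]; last first.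
  by rewrite -[l.*2.+1%:R]natr1 natr_double; field.
by rewrite /= uphalf_double mul2n addn1 -!natr_sum -natrX; exact/solve/Nbar_odd.
Qed.
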